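(* The function $G$ extends to a meromorphic function on $\mathbb C$. Its poles are exactly the points $t=2ki-\frac{i}{2}$ for $k\in\mathbb N=\{1,2,\dots\}$ and $t=-2\pi n^2$ for $n\in\mathbb N$, and all of them are simple.
   Context: $G$ is defined by the series $G(t)=\sum_{n=1}^\infty n^{-\frac12-it}\,\frac{t}{2\pi n^2+t}$, which converges absolutely and defines a meromorphic function on $\{t\in\mathbb C:\Im t<\frac32\}$. *)

(* Defs.v *)
From Stdlib Require Import Reals.
From Coquelicot Require Import Coquelicot.
Open Scope R_scope.

Definition Cexp (z : C) : C :=
  (exp (Re z) * cos (Im z), exp (Re z) * sin (Im z)).

Definition Cnpow (n : nat) (s : C) : C := Cexp (Cmult s (RtoC (ln (INR n)))).

(* The n-th term (n >= 1) of G(t) = sum_n n^{-1/2 - i t} * t / (2 pi n^2 + t). *)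
Definition G_term (t : C) (n : nat) : C :=
  Cmult (Cnpow n (Cminus (RtoC (-(1/2))) (Cmult Ci t)))
        (Cdiv t (Cplus (RtoC (2 * PI * (INR n) ^ 2)) t)).

Definition C_holo_at (F : C -> C) (z : C) : Prop :=
  @ex_derive C_AbsRing C_NormedModule F z.

Definition G_pole (z : C) : Prop :=
  (exists k : nat, (1 <= k)%nat /\ z = (0, 2 * INR k - 1/2)) \/
  (exists n : nat, (1 <= n)%nat /\ z = (- (2 * PI * (INR n) ^ 2), 0)).

Definition simple_pole (F : C -> C) (p : C) : Prop :=
  exists c : C, c <> RtoC 0 /\
  exists r : R, 0 < r /\
  exists h : C -> C,
    (forall z, Cmod (Cminus z p) < r -> C_holo_at h z) /\
    (forall z, Cmod (Cminus z p) < r -> z <> p ->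
       F z = Cplus (Cdiv c (Cminus z p)) (h z)).

(* Main.v *)
Require Import Defs.
From Stdlib Require Import Reals Factorial Lra Lia.
From Coquelicot Require Import Coquelicot.
Open Scope R_scope.

(** With u = t/(2 pi n^2), the n-th term of G is n^(-1/2-it) u/(1+u).  Splitting off
    the first K terms of u/(1+u) = u - u^2 + ... gives, for Im t < 3/2,
      G(t) = sum_(1<=j<=K) (-1)^(j-1) (t/2pi)^j zeta(1/2+it+2j) + R_K(t),
    where the series R_K converges for Im t < 3/2 + 2K and has only the poles -2 pi n^2,
    while the j-th zeta value has its pole at t = 2ji - i/2.  The right-hand sides for
    different K agree wherever their remainders converge, so no identity theorem is needed.

    zeta(s) - 1/(s-1) is continued to C in the same spirit: sum (n+1)^(1-s) - n^(1-s) = -1,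
    expanded by the binomial theorem in powers of 1/n, expresses zeta(s) through
    zeta(s+1), ..., zeta(s+m) and a series converging for Re s > -m.

    Sums of series are shown to be holomorphic without Cauchy's theorem: it suffices that
    the difference quotients of the terms at the point are dominated by a summable sequence. *)

Local Notation is_derive_C := (@is_derive C_AbsRing C_NormedModule).
Local Notation is_derive_RC := (@is_derive R_AbsRing C_R_NormedModule).
Local Notation is_series_C := (@is_series C_AbsRing C_NormedModule).
Local Notation ex_series_C := (@ex_series C_AbsRing C_NormedModule).

(** * Complex numbers *)

Lemma im_le_Cmod (z : C) : Rabs (Im z) <= Cmod z.
Proof. eapply Rle_trans; [apply Rmax_r | apply (Rmax_Cmod z)]. Qed.

Lemma Cmod_minus_diag (z : C) : Cmod (z - z) = 0.
Proof. replace (z - z)%C with (RtoC 0) by ring. apply Cmod_0. Qed.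

Lemma Cmod_minus_sym (z w : C) : Cmod (z - w) = Cmod (w - z).
Proof. rewrite <- Cmod_opp. f_equal. ring. Qed.

Lemma Cmod_triangle_inv (z w : C) : Cmod z - Cmod w <= Cmod (z - w).
Proof. eapply Rle_trans; [apply Rle_abs | apply (norm_triangle_inv z w)]. Qed.

Lemma Cmod_minus_le (z w : C) : Cmod (z - w) <= Cmod z + Cmod w.
Proof. rewrite <- (Cmod_opp w). apply Cmod_triangle. Qed.

Lemma Re_close (z w : C) (r : R) : Cmod (w - z) < r -> Re z - r < Re w < Re z + r.
Proof.
  intros Hw. pose proof (re_le_Cmod (w - z)) as Hre.
  change (Re (w - z)%C) with (Re w - Re z) in Hre.
  assert (Hlt : Rabs (Re w - Re z) < r) by lra. apply Rabs_def2 in Hlt. lra.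
Qed.

Lemma Im_close (z w : C) (r : R) : Cmod (w - z) < r -> Im z - r < Im w < Im z + r.
Proof.
  intros Hw. pose proof (im_le_Cmod (w - z)) as Him.
  change (Im (w - z)%C) with (Im w - Im z) in Him.
  assert (Hlt : Rabs (Im w - Im z) < r) by lra. apply Rabs_def2 in Hlt. lra.
Qed.

Lemma Cminus_neq_0 (z w : C) : z <> w -> (z - w)%C <> 0.
Proof. intros Hzw E. apply Hzw. replace z with (z - w + w)%C by ring. rewrite E. ring. Qed.

Lemma Cdiv_neq_0 (z w : C) : z <> 0 -> w <> 0 -> (z / w)%C <> 0.
Proof.
  intros Hz Hw E. apply Hz. replace z with (z / w * w)%C by (field; exact Hw).
  rewrite E. ring.
Qed.

Lemma Re_neq_0 (z : C) : Re z <> 0 -> z <> 0.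
Proof. now intros Hz ->. Qed.

Lemma Im_neq_0 (z : C) : Im z <> 0 -> z <> 0.
Proof. now intros Hz ->. Qed.

Lemma RtoC_neq_0 (x : R) : x <> 0 -> RtoC x <> 0.
Proof. apply (Re_neq_0 x). Qed.

Lemma RtoC_INR_S (n : nat) : RtoC (INR (S n)) = (RtoC (INR n) + 1)%C.
Proof. rewrite S_INR. apply RtoC_plus. Qed.

Lemma RtoC_INR_S_neq_0 (n : nat) : RtoC (INR (S n)) <> 0.
Proof. apply RtoC_neq_0, not_0_INR. lia. Qed.

Lemma INR_S_ge_1 (n : nat) : 1 <= INR (S n).
Proof. rewrite S_INR. pose proof (pos_INR n). lra. Qed.

Lemma exp_le_compat (x y : R) : x <= y -> exp x <= exp y.
Proof. intros [Hxy | ->]; [left; now apply exp_increasing | apply Rle_refl]. Qed.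

(** * Differentiability *)

Lemma is_derive_locally {K : AbsRing} {V : NormedModule K} (f : K -> V) (x : K) (l : V) :
  is_derive f x l <->
  forall eps : posreal, locally x (fun y =>
    norm (minus (minus (f y) (f x)) (scal (minus y x) l)) <= eps * norm (minus y x)).
Proof.
  split.
  - intros [_ Hdom]. exact (Hdom x (fun P HP => HP)).
  - intros Hloc. split; [apply is_linear_scal_l|]. intros y Hy.
    now rewrite <- (is_filter_lim_locally_unique (V := AbsRing_NormedModule K) x y Hy).
Qed.

Lemma is_derive_linear {K : AbsRing} {U V : NormedModule K}
  (L : U -> V) (f : K -> U) (x : K) (l : U) :
  is_linear L -> is_derive f x l -> is_derive (fun y => L (f y)) x (L l).
Proof.
  intros HL Hf. apply filterdiff_ext_lin with (fun y => L (scal y l)).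
  - apply (filterdiff_comp' f L); [exact Hf | now apply filterdiff_linear].
  - intros y. now apply linear_scal.
Qed.

Lemma is_derive_pair {K : AbsRing} {U V : NormedModule K}
  (f : K -> U) (g : K -> V) (x : K) (l : U) (m : V) :
  is_derive f x l -> is_derive g x m ->
  is_derive (V := prod_NormedModule K U V) (fun y => (f y, g y)) x (l, m).
Proof.
  intros Hf Hg.
  apply (filterdiff_comp'_2 (W := prod_NormedModule K U V) f g (fun u v => (u, v)) x
           (fun y => scal y l) (fun y => scal y m) (fun u v => (u, v)) Hf Hg).
  apply (filterdiff_linear (V := prod_NormedModule K U V)).
  apply is_linear_prod; [apply is_linear_fst | apply is_linear_snd].
Qed.

(* [C_NormedModule] carries the product topology, hence is not convertible to
   [AbsRing_NormedModule C_AbsRing]. *)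
Lemma is_derive_C_AbsRing (f : C -> C) (z l : C) :
  is_derive_C f z l <-> @is_derive C_AbsRing (AbsRing_NormedModule C_AbsRing) f z l.
Proof. rewrite 2 is_derive_locally. reflexivity. Qed.

Lemma is_derive_C_epsilon_delta (f : C -> C) (z l : C) : is_derive_C f z l <->
  forall eps, 0 < eps -> exists d, 0 < d /\ forall w, Cmod (w - z) < d ->
    Cmod (f w - f z - (w - z) * l) <= eps * Cmod (w - z).
Proof.
  rewrite is_derive_locally. split.
  - intros Hf eps Heps. destruct (Hf (mkposreal eps Heps)) as [d Hd].
    exists d. split; [apply cond_pos | exact Hd].
  - intros Hf eps. destruct (Hf eps (cond_pos eps)) as [d [Hd Hfd]].
    exists (mkposreal d Hd). exact Hfd.
Qed.

Lemma C_holo_at_is_derive (f : C -> C) (z : C) :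
  C_holo_at f z -> is_derive_C f z (C_derive f z).
Proof. intros [l Hl]. now rewrite (is_C_derive_unique f z l Hl). Qed.

Lemma C_holo_at_ext_loc (f g : C -> C) (z : C) (r : R) : 0 < r ->
  (forall w, Cmod (w - z) < r -> f w = g w) -> C_holo_at f z -> C_holo_at g z.
Proof.
  intros Hr Hfg. apply ex_derive_ext_loc. now exists (mkposreal r Hr).
Qed.

Lemma C_holo_at_ext (f g : C -> C) (z : C) :
  (forall w, f w = g w) -> C_holo_at f z -> C_holo_at g z.
Proof. apply ex_derive_ext. Qed.

Lemma C_holo_at_const (c z : C) : C_holo_at (fun _ => c) z.
Proof. exact (ex_derive_const c z). Qed.

Lemma C_holo_at_id (z : C) : C_holo_at (fun w => w) z.
Proof. eexists. apply is_derive_C_AbsRing, (@is_derive_id C_AbsRing). Qed.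

Lemma C_holo_at_plus (f g : C -> C) (z : C) :
  C_holo_at f z -> C_holo_at g z -> C_holo_at (fun w => f w + g w)%C z.
Proof. exact (ex_derive_plus f g z). Qed.

Lemma C_holo_at_opp (f : C -> C) (z : C) : C_holo_at f z -> C_holo_at (fun w => - f w)%C z.
Proof. exact (ex_derive_opp f z). Qed.

Lemma C_holo_at_minus (f g : C -> C) (z : C) :
  C_holo_at f z -> C_holo_at g z -> C_holo_at (fun w => f w - g w)%C z.
Proof. exact (ex_derive_minus f g z). Qed.

Lemma C_holo_at_mult (f g : C -> C) (z : C) :
  C_holo_at f z -> C_holo_at g z -> C_holo_at (fun w => f w * g w)%C z.
Proof.
  intros [l Hf%is_derive_C_AbsRing] [m Hg%is_derive_C_AbsRing]. eexists.
  apply is_derive_C_AbsRing. exact (is_derive_mult f g z l m Hf Hg Cmult_comm).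
Qed.

Lemma C_holo_at_comp (f g : C -> C) (z : C) :
  C_holo_at f (g z) -> C_holo_at g z -> C_holo_at (fun w => f (g w)) z.
Proof.
  intros [l Hf] [m Hg%is_derive_C_AbsRing]. eexists. exact (is_derive_comp f g z l m Hf Hg).
Qed.

Lemma C_holo_at_sum_n (f : nat -> C -> C) (n : nat) (z : C) :
  (forall k, (k <= n)%nat -> C_holo_at (f k) z) ->
  C_holo_at (fun w => sum_n (fun k => f k w) n) z.
Proof. exact (ex_derive_sum_n f n z). Qed.

Lemma C_holo_at_Cinv (z : C) : z <> 0 -> C_holo_at Cinv z.
Proof.
  intros Hz. exists (- / (z * z))%C. apply is_derive_C_epsilon_delta. intros eps Heps.
  set (m := Cmod z). assert (Hm : 0 < m) by now apply Cmod_gt_0.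
  set (d := eps * (m / 2 * (m * m))).
  assert (Hd : 0 < d) by (unfold d; repeat apply Rmult_lt_0_compat; lra).
  exists (Rmin (m / 2) d). split; [apply Rmin_pos; lra|]. intros w Hw.
  pose proof (Rmin_l (m / 2) d). pose proof (Rmin_r (m / 2) d).
  assert (Hmw : m / 2 <= Cmod w).
  { pose proof (Cmod_triangle_inv z w). rewrite Cmod_minus_sym in Hw. unfold m in *. lra. }
  assert (Hw0 : w <> 0) by (apply Cmod_gt_0; lra).
  replace (/ w - / z - (w - z) * - / (z * z))%C with ((w - z) * (w - z) / (w * (z * z)))%C
    by (field; now split).
  rewrite Cmod_div, !Cmod_mult by (repeat apply Cmult_neq_0; assumption). fold m.
  pose proof (Cmod_ge_0 (w - z)) as Hwz. set (h := Cmod (w - z)) in *.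
  assert (Hmm : 0 < m * m) by nra.
  apply Rle_div_l; [nra|].
  assert (Hhd : h <= eps * (Cmod w * (m * m))).
  { apply Rle_trans with d; [lra|]. apply Rmult_le_compat_l; nra. }
  nra.
Qed.

Lemma C_holo_at_inv (f : C -> C) (z : C) :
  C_holo_at f z -> f z <> 0 -> C_holo_at (fun w => / f w)%C z.
Proof. intros Hf Hz. apply (C_holo_at_comp Cinv f); [now apply C_holo_at_Cinv | exact Hf]. Qed.

Lemma C_holo_at_div (f g : C -> C) (z : C) :
  C_holo_at f z -> C_holo_at g z -> g z <> 0 -> C_holo_at (fun w => f w / g w)%C z.
Proof. intros Hf Hg Hz. apply C_holo_at_mult; [exact Hf | now apply C_holo_at_inv]. Qed.

Lemma C_holo_at_pow (f : C -> C) (n : nat) (z : C) :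
  C_holo_at f z -> C_holo_at (fun w => f w ^ n)%C z.
Proof.
  intros Hf. induction n as [|n IH]; [exact (C_holo_at_const 1 z)|].
  exact (C_holo_at_mult f (fun w => f w ^ n)%C z Hf IH).
Qed.

Ltac holo := repeat match goal with
  | |- C_holo_at (fun _ => ?c) _ => apply C_holo_at_const
  | |- C_holo_at (fun w => w) _ => apply C_holo_at_id
  | |- C_holo_at (fun w => - @?f w)%C _ => apply (C_holo_at_opp f)
  | |- C_holo_at (fun w => @?f w + @?g w)%C _ => apply (C_holo_at_plus f g)
  | |- C_holo_at (fun w => @?f w - @?g w)%C _ => apply (C_holo_at_minus f g)
  | |- C_holo_at (fun w => @?f w * @?g w)%C _ => apply (C_holo_at_mult f g)
  | |- C_holo_at (fun w => @?f w / @?g w)%C _ => apply (C_holo_at_div f g)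
  | |- C_holo_at (fun w => @?f w ^ ?n)%C _ => apply (C_holo_at_pow f n)
  | _ => assumption
  end.

(** * Local Lipschitz bounds *)

Definition lip_bounded (f : C -> C) (z : C) (r M : R) : Prop :=
  forall w, Cmod (w - z) < r ->
    Cmod (f w) <= M /\ Cmod (f w - f z) <= M * Cmod (w - z).

Lemma lip_bounded_le (f : C -> C) (z : C) (r r' M M' : R) :
  r' <= r -> M <= M' -> lip_bounded f z r M -> lip_bounded f z r' M'.
Proof.
  intros Hr HM Hf w Hw. destruct (Hf w) as [Hb Hl]; [lra|].
  pose proof (Cmod_ge_0 (w - z)). split; [lra|].
  apply Rle_trans with (1 := Hl). now apply Rmult_le_compat_r.
Qed.

Lemma lip_bounded_ext (f g : C -> C) (z : C) (r M : R) : 0 < r ->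
  (forall w, Cmod (w - z) < r -> f w = g w) -> lip_bounded f z r M -> lip_bounded g z r M.
Proof.
  intros Hr Hfg Hf w Hw. rewrite <- !Hfg; [now apply Hf | rewrite Cmod_minus_diag; lra | lra].
Qed.

Lemma lip_bounded_isometry (f a : C -> C) (z : C) (r M : R) :
  (forall w, Cmod (a w - a z) = Cmod (w - z)) ->
  lip_bounded f (a z) r M -> lip_bounded (fun w => f (a w)) z r M.
Proof. intros Ha Hf w Hw. rewrite <- Ha in *. now apply Hf. Qed.

Lemma lip_bounded_minus_const (c z : C) (r : R) :
  lip_bounded (fun w => w - c)%C z r (Cmod z + Cmod c + r + 1).
Proof.
  intros w Hw. pose proof (Cmod_minus_le w c). pose proof (Cmod_triangle_inv w z).
  pose proof (Cmod_ge_0 z). pose proof (Cmod_ge_0 c). pose proof (Cmod_ge_0 (w - z)).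
  replace (w - c - (z - c))%C with (w - z)%C by ring. split; [lra | nra].
Qed.

Lemma lip_bounded_scal (c : C) (f : C -> C) (z : C) (r M : R) :
  lip_bounded f z r M -> lip_bounded (fun w => c * f w)%C z r (Cmod c * M).
Proof.
  intros Hf w Hw. destruct (Hf w Hw) as [Hb Hl].
  replace (c * f w - c * f z)%C with (c * (f w - f z))%C by ring.
  rewrite !Cmod_mult, Rmult_assoc. pose proof (Cmod_ge_0 c).
  split; now apply Rmult_le_compat_l.
Qed.

Lemma lip_bounded_mult (f g : C -> C) (z : C) (r A B : R) : 0 < r ->
  lip_bounded f z r A -> lip_bounded g z r B ->
  lip_bounded (fun w => f w * g w)%C z r (2 * A * B).
Proof.
  intros Hr Hf Hg w Hw. destruct (Hf w Hw) as [fw df]. destruct (Hg w Hw) as [gw dg].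
  destruct (Hf z) as [fz _]; [rewrite Cmod_minus_diag; lra|].
  pose proof (Cmod_ge_0 (f w)). pose proof (Cmod_ge_0 (g w)).
  rewrite Cmod_mult. split.
  - assert (Cmod (f w) * Cmod (g w) <= A * B) by (apply Rmult_le_compat; lra).
    assert (0 <= A * B) by (apply Rmult_le_pos; lra). lra.
  - replace (f w * g w - f z * g z)%C with ((f w - f z) * g w + f z * (g w - g z))%C by ring.
    eapply Rle_trans; [apply Cmod_triangle|]. rewrite !Cmod_mult.
    assert (Cmod (f w - f z) * Cmod (g w) <= A * Cmod (w - z) * B)
      by (apply Rmult_le_compat; auto using Cmod_ge_0).
    assert (Cmod (f z) * Cmod (g w - g z) <= A * (B * Cmod (w - z)))
      by (apply Rmult_le_compat; auto using Cmod_ge_0).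
    lra.
Qed.

Lemma lip_bounded_Cinv_shift (a z : C) (r m : R) : 1 <= m -> 0 < r ->
  (forall w, Cmod (w - z) < r -> m <= Cmod (a + w)) ->
  lip_bounded (fun w => / (a + w))%C z r (/ m).
Proof.
  intros Hm Hr Hlow w Hw.
  pose proof (Hlow w Hw) as Hmw.
  assert (Hmz : m <= Cmod (a + z)) by (apply Hlow; rewrite Cmod_minus_diag; lra).
  assert (Hw0 : (a + w)%C <> 0) by (apply Cmod_gt_0; lra).
  assert (Hz0 : (a + z)%C <> 0) by (apply Cmod_gt_0; lra).
  assert (Hiw : / Cmod (a + w) <= / m) by (apply Rinv_le_contravar; lra).
  rewrite Cmod_inv by exact Hw0. split; [exact Hiw|].
  replace (/ (a + w) - / (a + z))%C with (/ (a + w) * (/ (a + z) * - (w - z)))%C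
    by (field; now split).
  rewrite !Cmod_mult, !Cmod_inv, Cmod_opp by assumption.
  assert (Hiz : / Cmod (a + z) <= 1) by (rewrite <- Rinv_1; apply Rinv_le_contravar; lra).
  assert (0 < / Cmod (a + w)) by (apply Rinv_0_lt_compat; lra).
  assert (0 < / Cmod (a + z)) by (apply Rinv_0_lt_compat; lra).
  pose proof (Cmod_ge_0 (w - z)).
  apply Rmult_le_compat; try nra.
Qed.

Lemma C_holo_at_lip_bounded (f : C -> C) (z : C) :
  C_holo_at f z -> exists r M, 0 < r /\ lip_bounded f z r M.
Proof.
  intros [l Hf]. destruct (proj1 (is_derive_C_epsilon_delta f z l) Hf 1) as [d [Hd Hfd]]; [lra|].
  exists (Rmin 1 d), (Cmod (f z) + Cmod l + 1). split; [apply Rmin_pos; lra|]. intros w Hw.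
  pose proof (Rmin_l 1 d). pose proof (Rmin_r 1 d).
  pose proof (Cmod_ge_0 (f z)). pose proof (Cmod_ge_0 l). pose proof (Cmod_ge_0 (w - z)).
  assert (Hinc : Cmod (f w - f z) <= (Cmod l + 1) * Cmod (w - z)).
  { specialize (Hfd w ltac:(lra)).
    pose proof (Cmod_triangle_inv (f w - f z) ((w - z) * l)) as Htri.
    rewrite (Cmod_mult (w - z)) in Htri. lra. }
  pose proof (Cmod_triangle_inv (f w) (f z)). split; nra.
Qed.

Lemma Cmod_derive_le (f : C -> C) (z l : C) (r M : R) : 0 < r ->
  lip_bounded f z r M -> is_derive_C f z l -> Cmod l <= M.
Proof.
  intros Hr HL Hf. apply le_epsilon. intros eps Heps.
  destruct (proj1 (is_derive_C_epsilon_delta f z l) Hf eps Heps) as [d [Hd Hfd]].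
  set (h := Rmin d r / 2).
  pose proof (Rmin_pos d r Hd Hr). pose proof (Rmin_l d r). pose proof (Rmin_r d r).
  assert (Hz : (z + h - z)%C = RtoC h) by ring.
  assert (Hh : Cmod (z + h - z) = h)
    by (rewrite Hz, Cmod_R; apply Rabs_pos_eq; unfold h; lra).
  assert (0 < h) by (unfold h; lra).
  destruct (HL (z + h)%C) as [_ Hl]; [rewrite Hh; unfold h; lra|].
  specialize (Hfd (z + h)%C). rewrite Hh in Hl, Hfd.
  specialize (Hfd ltac:(unfold h; lra)). rewrite Cmod_minus_sym in Hfd.
  pose proof (Cmod_triangle_inv ((z + h - z) * l) (f (z + h)%C - f z)) as Htri.
  rewrite Cmod_mult, Hh in Htri. apply Rmult_le_reg_l with h; lra.
Qed.

(** * Complex series *)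

Definition CSeries (a : nat -> C) : C :=
  iota (fun l : C_CompleteNormedModule => is_series_C a l).

Lemma is_series_C_unique (a : nat -> C) (l : C) : is_series_C a l -> CSeries a = l.
Proof. exact (iota_filterlim_locally (V := C_CompleteNormedModule) (sum_n a) l). Qed.

Lemma CSeries_correct (a : nat -> C) : ex_series_C a -> is_series_C a (CSeries a).
Proof. intros [l Hl]. now rewrite (is_series_C_unique a l Hl). Qed.

Lemma ex_series_C_le (a : nat -> C) (M : nat -> R) :
  (forall n, Cmod (a n) <= M n) -> ex_series M -> ex_series_C a.
Proof. exact (ex_series_le (V := C_CompleteNormedModule) a M). Qed.

Lemma CSeries_ext (a b : nat -> C) :
  (forall n, a n = b n) -> ex_series_C b -> CSeries a = CSeries b.
Proof.
  intros Hab Hb. apply is_series_C_unique, is_series_ext with b; [easy|]. now apply CSeries_correct.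
Qed.

Lemma ex_series_C_plus (a b : nat -> C) :
  ex_series_C a -> ex_series_C b -> ex_series_C (fun n => a n + b n)%C.
Proof. exact (ex_series_plus a b). Qed.

Lemma ex_series_C_minus (a b : nat -> C) :
  ex_series_C a -> ex_series_C b -> ex_series_C (fun n => a n - b n)%C.
Proof. exact (ex_series_minus a b). Qed.

Lemma ex_series_C_scal (c : C) (a : nat -> C) :
  ex_series_C a -> ex_series_C (fun n => c * a n)%C.
Proof. exact (ex_series_scal (V := C_NormedModule) c a). Qed.

Lemma CSeries_plus (a b : nat -> C) : ex_series_C a -> ex_series_C b ->
  CSeries (fun n => a n + b n)%C = (CSeries a + CSeries b)%C.
Proof.
  intros Ha Hb. apply is_series_C_unique. apply (is_series_plus a b); now apply CSeries_correct.
Qed.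

Lemma CSeries_minus (a b : nat -> C) : ex_series_C a -> ex_series_C b ->
  CSeries (fun n => a n - b n)%C = (CSeries a - CSeries b)%C.
Proof.
  intros Ha Hb. apply is_series_C_unique. apply (is_series_minus a b); now apply CSeries_correct.
Qed.

Lemma CSeries_scal (c : C) (a : nat -> C) : ex_series_C a ->
  CSeries (fun n => c * a n)%C = (c * CSeries a)%C.
Proof.
  intros Ha. apply is_series_C_unique.
  apply (is_series_scal (V := C_NormedModule) c a). now apply CSeries_correct.
Qed.

Lemma CSeries_incr_n (a : nat -> C) (n : nat) : ex_series_C a ->
  CSeries a = (sum_n a n + CSeries (fun k => a (S n + k)%nat))%C.
Proof.
  intros Ha. apply is_series_C_unique, (is_series_decr_n a (S n)); [lia|].
  replace (plus _ _) with (CSeries (fun k => a (S n + k)%nat)).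
  - apply CSeries_correct. now apply (ex_series_incr_n a (S n)).
  - change (CSeries (fun k => a (S n + k)%nat)
      = sum_n a n + CSeries (fun k => a (S n + k)%nat) - sum_n a n)%C. ring.
Qed.

Definition omit (m : nat) (a : nat -> C) (n : nat) : C := if Nat.eqb n m then 0 else a n.

Lemma omit_eq (m : nat) (a : nat -> C) : omit m a m = 0.
Proof. unfold omit. now rewrite Nat.eqb_refl. Qed.

Lemma omit_neq (m n : nat) (a : nat -> C) : n <> m -> omit m a n = a n.
Proof. intros Hn%Nat.eqb_neq. unfold omit. now rewrite Hn. Qed.

Lemma sum_n_omit (a : nat -> C) (m : nat) : sum_n a m = (a m + sum_n (omit m a) m)%C.
Proof.
  destruct m as [|m].
  { rewrite !sum_O, omit_eq. symmetry. apply Cplus_0_r. }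
  rewrite !sum_Sn, omit_eq, (sum_n_ext_loc (omit (S m) a) a)
    by (intros n Hn; apply omit_neq; lia).
  change (sum_n a m + a (S m) = a (S m) + (sum_n a m + 0))%C. ring.
Qed.

Lemma CSeries_omit (a : nat -> C) (m : nat) : ex_series_C a ->
  CSeries a = (a m + CSeries (omit m a))%C.
Proof.
  intros Ha.
  assert (Htail : forall k, a (S m + k)%nat = omit m a (S m + k)%nat)
    by (intros k; symmetry; apply omit_neq; lia).
  assert (Hom : ex_series_C (omit m a)).
  { apply (ex_series_incr_n (omit m a) (S m)). apply ex_series_ext with (1 := Htail).
    now apply (ex_series_incr_n a (S m)). }
  rewrite (CSeries_incr_n a m), (CSeries_incr_n (omit m a) m), sum_n_omit by assumption.
  rewrite (CSeries_ext _ _ Htail) by now apply (ex_series_incr_n (omit m a) (S m)). ring.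
Qed.

Lemma norm_series_le {K : AbsRing} {V : NormedModule K} (a : nat -> V) (l : V) (M : nat -> R) :
  is_series a l -> ex_series M -> (forall n, norm (a n) <= M n) -> norm l <= Series M.
Proof.
  intros Ha HM Hle. pose proof (Series_correct M HM) as HS.
  apply (filterlim_le (F := eventually) (fun n => norm (sum_n a n)) (sum_n M) (norm l) (Series M)).
  - exists 0%nat. intros n _.
    eapply Rle_trans; [apply (norm_sum_n_m a) | now apply sum_n_m_le].
  - exact (filterlim_comp _ _ _ _ _ _ _ _ Ha (filterlim_norm l)).
  - exact HS.
Qed.

Lemma is_series_telescope {K : AbsRing} {V : NormedModule K} (u : nat -> V) (l : V) :
  filterlim u eventually (locally l) ->
  is_series (fun n => minus (u (S n)) (u n)) (minus l (u 0%nat)).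
Proof.
  intros Hu. unfold is_series.
  apply filterlim_ext with (fun n => minus (u (S n)) (u 0%nat)).
  - intros n. induction n as [|n IH]; [now rewrite sum_O|].
    rewrite sum_Sn, <- IH, plus_comm. apply (minus_trans (u (S n)) (u (S (S n)))).
  - apply (filterlim_comp_2 (fun n => u (S n)) (fun _ => opp (u 0%nat)) plus
      (G := locally l) (H := locally (opp (u 0%nat)))).
    + apply (filterlim_comp _ _ _ S u _ eventually); [apply eventually_subseq; lia | exact Hu].
    + apply filterlim_const.
    + apply filterlim_plus.
Qed.

Lemma Series_tail_small (M : nat -> R) (N : nat) (eps : R) : ex_series M -> 0 < eps ->
  exists n, (N <= n)%nat /\ Series (fun k => M (S n + k)%nat) < eps.
Proof.
  intros HM Heps. pose proof (Series_correct M HM) as Hlim.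
  destruct (proj1 (filterlim_locally (F := eventually) _ _) Hlim (mkposreal eps Heps))
    as [n0 Hn0].
  exists (max N n0). split; [lia|]. specialize (Hn0 (max N n0) ltac:(lia)).
  apply Rabs_def2 in Hn0. rewrite (Series_incr_n M (S (max N n0))) in Hn0 by (lia || easy).
  rewrite sum_n_Reals in Hn0. unfold minus, plus, opp in Hn0; simpl in Hn0. simpl. lra.
Qed.

Lemma Cmod_CSeries_increment_le (a b l : nat -> C) (M : nat -> R) (h : C) :
  ex_series M -> ex_series_C a -> ex_series_C b ->
  (forall n, Cmod (a n - b n) <= M n * Cmod h) -> (forall n, Cmod (l n) <= M n) ->
  Cmod (CSeries a - CSeries b - h * CSeries l) <= 2 * Series M * Cmod h.
Proof.
  intros HM Ha Hb Hab Hl. assert (Hls : ex_series_C l) by now apply ex_series_C_le with M.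
  rewrite <- CSeries_scal, <- !CSeries_minus by auto using ex_series_C_minus, ex_series_C_scal.
  replace (2 * Series M * Cmod h) with (2 * Cmod h * Series M) by ring.
  rewrite <- Series_scal_l.
  apply (norm_series_le (V := C_NormedModule) (fun n => a n - b n - h * l n)%C).
  - apply CSeries_correct. auto using ex_series_C_minus, ex_series_C_scal.
  - now apply (ex_series_scal (2 * Cmod h) M).
  - intros n. change (Cmod (a n - b n - h * l n) <= 2 * Cmod h * M n).
    eapply Rle_trans; [apply Cmod_minus_le|]. rewrite Cmod_mult.
    specialize (Hab n). pose proof (Rmult_le_compat_l _ _ _ (Cmod_ge_0 h) (Hl n)). lra.
Qed.

Definition locally_dominated (f : nat -> C -> C) (z : C) : Prop :=
  exists (r : R) (M : nat -> R) (N : nat), 0 < r /\ ex_series M /\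
    forall n, (N <= n)%nat -> lip_bounded (f n) z r (M n).

Lemma ex_series_C_eventually_le (a : nat -> C) (M : nat -> R) (N : nat) :
  (forall n, (N <= n)%nat -> Cmod (a n) <= M n) -> ex_series M -> ex_series_C a.
Proof.
  intros Hle HM. apply (ex_series_incr_n a N).
  apply ex_series_C_le with (fun k => M (N + k)%nat); [|now apply ex_series_incr_n].
  intros k. apply Hle. lia.
Qed.

Lemma locally_dominated_ex_series (f : nat -> C -> C) (z : C) :
  locally_dominated f z -> ex_series_C (fun n => f n z).
Proof.
  intros [r [M [N [Hr [HM HL]]]]]. apply ex_series_C_eventually_le with M N; [|exact HM].
  intros n Hn. apply (HL n Hn). now rewrite Cmod_minus_diag.
Qed.

Lemma locally_dominated_ext (f g : nat -> C -> C) (z : C) (r : R) (N : nat) : 0 < r ->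
  (forall n w, (N <= n)%nat -> Cmod (w - z) < r -> f n w = g n w) ->
  locally_dominated f z -> locally_dominated g z.
Proof.
  intros Hr Hfg [r' [M [N' [Hr' [HM HL]]]]].
  exists (Rmin r r'), M, (max N N'). split; [now apply Rmin_pos|]. split; [exact HM|].
  intros n Hn. pose proof (Rmin_l r r'). pose proof (Rmin_r r r').
  apply lip_bounded_ext with (f n); [now apply Rmin_pos | |].
  - intros w Hw. apply Hfg; [lia | lra].
  - apply lip_bounded_le with r' (M n); [easy | lra|]. apply HL. lia.
Qed.

Lemma locally_dominated_omit (f : nat -> C -> C) (z : C) (m : nat) :
  locally_dominated f z -> locally_dominated (fun n w => omit m (fun k => f k w) n) z.
Proof.
  apply locally_dominated_ext with 1 (S m); [lra|]. intros n w Hn _.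
  symmetry. apply omit_neq. lia.
Qed.

Lemma C_holo_at_CSeries (f : nat -> C -> C) (z : C) :
  locally_dominated f z -> (forall n, C_holo_at (f n) z) ->
  C_holo_at (fun w => CSeries (fun n => f n w)) z.
Proof.
  intros [r [M [N [Hr [HM HL]]]]] Hf.
  set (l n := C_derive (f n) z).
  assert (Hl : forall n, is_derive_C (f n) z (l n))
    by (intros n; now apply C_holo_at_is_derive).
  assert (HlM : forall n, (N <= n)%nat -> Cmod (l n) <= M n)
    by (intros n Hn; now apply (Cmod_derive_le (f n) z (l n) r); auto).
  assert (Hls : ex_series_C l) by now apply ex_series_C_eventually_le with M N.
  assert (Hfs : forall w, Cmod (w - z) < r -> ex_series_C (fun n => f n w)).
  { intros w Hw. apply ex_series_C_eventually_le with M N; [|exact HM].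
    intros n Hn. now apply (HL n Hn). }
  exists (CSeries l). apply is_derive_C_epsilon_delta. intros eps Heps.
  destruct (Series_tail_small M N (eps / 4) HM) as [n [Hn Htail]]; [lra|].
  destruct (proj1 (is_derive_C_epsilon_delta _ _ _)
    (is_derive_sum_n f n z l (fun k _ => Hl k)) (eps / 2)) as [d [Hd Hhead]]; [lra|].
  exists (Rmin d r). split; [now apply Rmin_pos|]. intros w Hw.
  pose proof (Rmin_l d r). pose proof (Rmin_r d r).
  assert (Hz : Cmod (z - z) < r) by now rewrite Cmod_minus_diag.
  rewrite (CSeries_incr_n l n), (CSeries_incr_n (fun k => f k w) n),
    (CSeries_incr_n (fun k => f k z) n) by (try apply Hfs; lra || easy).
  specialize (Hhead w ltac:(lra)).
  assert (Hrest := Cmod_CSeries_increment_le (fun k => f (S n + k)%nat w)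
    (fun k => f (S n + k)%nat z) (fun k => l (S n + k)%nat) (fun k => M (S n + k)%nat) (w - z)
    (proj1 (ex_series_incr_n M (S n)) HM)
    (proj1 (ex_series_incr_n _ (S n)) (Hfs w ltac:(lra)))
    (proj1 (ex_series_incr_n _ (S n)) (Hfs z Hz))
    (fun k => proj2 (HL (S n + k)%nat ltac:(lia) w ltac:(lra)))
    (fun k => HlM (S n + k)%nat ltac:(lia))).
  match goal with |- Cmod (?A + ?B - (?C + ?D) - ?h * (?E + ?F)) <= _ =>
    replace (A + B - (C + D) - h * (E + F))%C
      with ((A - C - h * E) + (B - D - h * F))%C by ring end.
  eapply Rle_trans; [apply Cmod_triangle|].
  eapply Rle_trans; [apply Rplus_le_compat; [exact Hhead | exact Hrest]|].
  pose proof (Rmult_le_compat_r _ _ _ (Cmod_ge_0 (w - z)) (Rlt_le _ _ Htail)). lra.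
Qed.

(** * Complex functions of a real variable *)

Lemma is_linear_Cmult (c : C) :
  @is_linear R_AbsRing C_R_NormedModule C_R_NormedModule (Cmult c).
Proof.
  split.
  - exact (Cmult_plus_distr_l c).
  - intros k u. rewrite !scal_R_Cmult. change (c * (k * u) = k * (c * u))%C. ring.
  - exists (Cmod c + 1). pose proof (Cmod_ge_0 c). split; [lra|]. intros u.
    apply Rle_trans with (Cmod (c * u)); [right; symmetry; apply Cmod_norm|].
    apply Rle_trans with ((Cmod c + 1) * Cmod u); [|right; f_equal; apply Cmod_norm].
    rewrite Cmod_mult. pose proof (Cmod_ge_0 u). lra.
Qed.

Lemma is_derive_RC_ext (f g : R -> C) (x : R) (l : C) :
  (forall y, f y = g y) -> is_derive_RC f x l -> is_derive_RC g x l.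
Proof. exact (is_derive_ext f g x l). Qed.

Lemma is_derive_RC_scal (c : C) (f : R -> C) (x : R) (l : C) :
  is_derive_RC f x l -> is_derive_RC (fun y => c * f y)%C x (c * l)%C.
Proof.
  apply (is_derive_linear (U := C_R_NormedModule) (V := C_R_NormedModule) (Cmult c)).
  apply is_linear_Cmult.
Qed.

Lemma is_derive_RC_minus (f g : R -> C) (x : R) (l m : C) :
  is_derive_RC f x l -> is_derive_RC g x m -> is_derive_RC (fun y => f y - g y)%C x (l - m)%C.
Proof. exact (is_derive_minus f g x l m). Qed.

Lemma is_derive_RC_RtoC (g : R -> R) (x l : R) :
  is_derive g x l -> is_derive_RC (fun y => RtoC (g y)) x (RtoC l).
Proof.
  intros Hg. apply (is_derive_pair g (fun _ => 0)); [exact Hg | apply @is_derive_const].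
Qed.

Lemma is_derive_RC_Cexp (c : C) (g : R -> R) (x l : R) : is_derive g x l ->
  is_derive_RC (fun y => Cexp (c * g y)) x (c * l * Cexp (c * g x))%C.
Proof.
  intros Hg. assert (Hex : ex_derive g x) by now exists l.
  pose proof (is_derive_unique _ _ _ Hg) as HD. destruct c as [a b].
  assert (Hexp : forall t, Cexp ((a, b) * RtoC t)
    = (exp (a * t) * cos (b * t), exp (a * t) * sin (b * t))).
  { intros t. unfold Cexp, Cmult, RtoC, Re, Im; simpl. f_equal; do 2 f_equal; ring. }
  replace (_ * Cexp _)%C with
    ((a * l) * (exp (a * g x) * cos (b * g x)) - (b * l) * (exp (a * g x) * sin (b * g x)),
     (a * l) * (exp (a * g x) * sin (b * g x)) + (b * l) * (exp (a * g x) * cos (b * g x)))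
    by (rewrite Hexp; unfold Cmult, RtoC; simpl; f_equal; ring).
  apply is_derive_RC_ext
    with (fun y => (exp (a * g y) * cos (b * g y), exp (a * g y) * sin (b * g y)));
    [intros y; now rewrite Hexp|].
  apply @is_derive_pair; auto_derive; try easy;
    change (Derive (fun y => g y) x) with (Derive g x); rewrite HD; ring.
Qed.

Lemma RC_mean_value (f f' : R -> C) (a b B : R) : a <= b ->
  (forall y, a <= y <= b -> is_derive_RC f y (f' y)) ->
  (forall y, a <= y <= b -> Cmod (f' y) <= B) ->
  Cmod (f b - f a) <= B * (b - a).
Proof.
  intros Hab Hd HB.
  (* The real mean value theorem for the component of [f] in the direction of [f b - f a]. *)
  set (D := (f b - f a)%C). set (L := fun u : C => Re (Cconj D * u)).
  assert (HL : @is_linear R_AbsRing C_R_NormedModule R_NormedModule L)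
    by exact (is_linear_comp (V := C_R_NormedModule) (W := R_NormedModule)
                (Cmult (Cconj D)) fst (is_linear_Cmult _) is_linear_fst).
  assert (HLd : forall y, a <= y <= b -> is_derive (fun t => L (f t)) y (L (f' y)))
    by (intros y Hy; apply (is_derive_linear (U := C_R_NormedModule) L); auto).
  destruct (MVT_gen (fun y => L (f y)) a b (fun y => L (f' y))) as [c [Hc E]].
  - intros y Hy. rewrite Rmin_left, Rmax_right in Hy by easy. apply HLd. lra.
  - intros y Hy. rewrite Rmin_left, Rmax_right in Hy by easy.
    apply continuity_pt_filterlim, (ex_derive_continuous (fun y => L (f y))).
    eexists. apply HLd. lra.
  - rewrite Rmin_left, Rmax_right in Hc by easy.
    assert (HLD : L (f b) - L (f a) = Cmod D ^ 2)
      by (rewrite Cmod2_alt; unfold L, D, Cconj, Cmult, Re, Im; simpl; ring).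
    assert (HLc : L (f' c) <= Cmod D * B).
    { eapply Rle_trans; [apply Rle_abs|]. eapply Rle_trans; [apply re_le_Cmod|].
      rewrite Cmod_mult, Cmod_conj. apply Rmult_le_compat_l; [apply Cmod_ge_0 | now apply HB]. }
    rewrite HLD in E.
    destruct (Cmod_ge_0 D) as [HD | <-].
    + apply Rmult_le_reg_l with (1 := HD).
      pose proof (Rmult_le_compat_r (b - a) _ _ ltac:(lra) HLc). lra.
    + apply Rmult_le_pos; [|lra]. eapply Rle_trans; [apply Cmod_ge_0 | apply (HB a); lra].
Qed.

Lemma lip_bounded_of_derive (F F' : C -> R -> C) (e : C) (r x B : R) : 0 <= x ->
  (forall w, F w 0 = 0) ->
  (forall w y, 0 <= y <= x -> is_derive_RC (F w) y (F' w y)) ->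
  (forall y, 0 <= y <= x -> lip_bounded (fun w => F' w y) e r B) ->
  lip_bounded (fun w => F w x) e r (B * x).
Proof.
  intros Hx H0 Hd HL w Hw. replace (B * x) with (B * (x - 0)) by ring. split.
  - replace (F w x) with (F w x - F w 0)%C by (rewrite H0; ring).
    apply RC_mean_value with (F' w); [easy | now intros; apply Hd|].
    intros y Hy. now apply (HL y Hy).
  - replace (F w x - F e x)%C with ((F w x - F e x) - (F w 0 - F e 0))%C by (rewrite !H0; ring).
    replace (B * (x - 0) * Cmod (w - e)) with (B * Cmod (w - e) * (x - 0)) by ring.
    apply (RC_mean_value (fun y => F w y - F e y)%C (fun y => F' w y - F' e y)%C); [easy| |].
    + intros y Hy. apply is_derive_RC_minus; now apply Hd.
    + intros y Hy. now apply (HL y Hy).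
Qed.

(** * The complex exponential *)

Lemma Cexp_plus (z w : C) : Cexp (z + w) = (Cexp z * Cexp w)%C.
Proof.
  destruct z as [a b], w as [c d]. unfold Cexp, Cplus, Cmult, Re, Im; simpl.
  rewrite exp_plus, cos_plus, sin_plus. f_equal; ring.
Qed.

Lemma Cexp_RtoC (x : R) : Cexp (RtoC x) = RtoC (exp x).
Proof. unfold Cexp, RtoC, Re, Im; simpl. rewrite cos_0, sin_0. f_equal; ring. Qed.

Lemma Cexp_0 : Cexp 0 = 1.
Proof. rewrite Cexp_RtoC. now rewrite exp_0. Qed.

Lemma Cmod_Cexp (z : C) : Cmod (Cexp z) = exp (Re z).
Proof.
  apply Rsqr_inj; [apply Cmod_ge_0 | left; apply exp_pos|].
  rewrite !Rsqr_pow2, Cmod2_alt. unfold Cexp; simpl.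
  pose proof (sin2_cos2 (Im z)) as Htrig. unfold Rsqr in Htrig.
  transitivity (exp (Re z) * exp (Re z) * (sin (Im z) * sin (Im z) + cos (Im z) * cos (Im z)));
    [ring | rewrite Htrig; ring].
Qed.

Lemma Cexp_neq_0 (z : C) : Cexp z <> 0.
Proof. apply Cmod_gt_0. rewrite Cmod_Cexp. apply exp_pos. Qed.

Lemma Cmod_Cexp_le (z : C) : Cmod (Cexp z) <= exp (Cmod z).
Proof.
  rewrite Cmod_Cexp. apply exp_le_compat.
  eapply Rle_trans; [apply Rle_abs | apply re_le_Cmod].
Qed.

Fixpoint Cexp_rem (n : nat) (z : C) : C :=
  match n with
  | O => Cexp z
  | S k => (Cexp_rem k z - z ^ k / INR (fact k))%C
  end.

Lemma Cexp_rem_S_0 (n : nat) : Cexp_rem (S n) 0 = 0.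
Proof.
  induction n as [|n IH].
  - simpl. rewrite Cexp_0. field.
  - change (Cexp_rem (S n) 0 - 0 ^ S n / INR (fact (S n)) = 0)%C.
    rewrite IH, Cpow_S. unfold Cdiv. ring.
Qed.

Lemma is_derive_RC_Cexp_rem (n : nat) (z : C) (y : R) :
  is_derive_RC (fun t => Cexp_rem (S n) (z * t)) y (z * Cexp_rem n (z * y))%C.
Proof.
  induction n as [|n IH].
  - replace (z * Cexp_rem 0 (z * y))%C with (z * 1 * Cexp (z * y) - 0)%C by (simpl; ring).
    apply (is_derive_RC_minus (fun t => Cexp (z * t)) (fun t => (z * t) ^ 0 / INR (fact 0))%C).
    + apply (is_derive_RC_Cexp z (fun t => t)), (@is_derive_id R_AbsRing).
    + simpl. exact (is_derive_const _ _).
  - replace (z * Cexp_rem (S n) (z * y))%C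
      with (z * Cexp_rem n (z * y)
            - z ^ S n / INR (fact (S n)) * RtoC (INR (S n) * y ^ n))%C.
    + apply (is_derive_RC_minus (fun t => Cexp_rem (S n) (z * t))
        (fun t => (z * t) ^ S n / INR (fact (S n)))%C); [exact IH|].
      apply is_derive_RC_ext with (fun t => z ^ S n / INR (fact (S n)) * RtoC (t ^ S n))%C.
      * intros t. rewrite Cpow_mult_l, <- RtoC_pow. unfold Cdiv. ring.
      * apply is_derive_RC_scal, is_derive_RC_RtoC.
        apply is_derive_Reals, (derivable_pt_lim_pow y (S n)).
    + change (Cexp_rem (S n) (z * y)) with (Cexp_rem n (z * y) - (z * y) ^ n / INR (fact n))%C.
      rewrite fact_simpl, mult_INR, !RtoC_mult, Cpow_mult_l, <- RtoC_pow, Cpow_S.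
      assert (RtoC (INR (fact n)) <> 0) by apply RtoC_neq_0, INR_fact_neq_0.
      pose proof (RtoC_INR_S_neq_0 n). field. now split.
Qed.

Lemma Cexp_rem_bound (n : nat) (z : C) : Cmod (Cexp_rem n z) <= Cmod z ^ n * exp (Cmod z).
Proof.
  revert z. induction n as [|n IH]; intros z; [simpl; rewrite Rmult_1_l; apply Cmod_Cexp_le|].
  replace (Cexp_rem (S n) z) with (Cexp_rem (S n) (z * 1) - Cexp_rem (S n) (z * 0))%C
    by (rewrite Cmult_0_r, Cexp_rem_S_0, Cmult_1_r; ring).
  replace (Cmod z ^ S n * exp (Cmod z)) with (Cmod z * (Cmod z ^ n * exp (Cmod z)) * (1 - 0))
    by (simpl; ring).
  apply (RC_mean_value (fun t => Cexp_rem (S n) (z * t)) (fun t => z * Cexp_rem n (z * t))%C);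
    [lra | intros; apply is_derive_RC_Cexp_rem|].
  intros y Hy. rewrite Cmod_mult. apply Rmult_le_compat_l; [apply Cmod_ge_0|].
  eapply Rle_trans; [apply IH|].
  assert (Hzy : Cmod (z * y) <= Cmod z).
  { rewrite Cmod_mult, Cmod_R, Rabs_pos_eq by easy. pose proof (Cmod_ge_0 z). nra. }
  apply Rmult_le_compat; [apply pow_le, Cmod_ge_0 | left; apply exp_pos | |].
  - apply pow_incr. split; [apply Cmod_ge_0 | exact Hzy].
  - now apply exp_le_compat.
Qed.

Lemma Cexp_rem_1 (z : C) : Cexp_rem 1 z = (Cexp z - 1)%C.
Proof. unfold Cexp_rem. change (INR (fact 0)) with 1. simpl. field. Qed.

Lemma Cexp_rem_3 (z : C) : Cexp_rem 3 z = (Cexp z - 1 - z - z * z / 2)%C.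
Proof.
  unfold Cexp_rem. change (INR (fact 0)) with 1. change (INR (fact 1)) with 1.
  change (INR (fact 2)) with 2. rewrite !Cpow_S; simpl. field.
Qed.

Definition expq (z : C) : C := if Ceq_dec z 0 then 1 else ((Cexp z - 1) / z)%C.

Lemma expq_0 : expq 0 = 1.
Proof. unfold expq. now destruct (Ceq_dec 0 0). Qed.

Lemma Cexp_expq (z : C) : Cexp z = (1 + z * expq z)%C.
Proof.
  unfold expq. destruct (Ceq_dec z 0) as [-> | Hz]; [rewrite Cexp_0; ring | field; exact Hz].
Qed.

Lemma C_holo_at_expq_0 : C_holo_at expq 0.
Proof.
  exists (/ 2)%C. apply is_derive_C_epsilon_delta. intros eps Heps.
  pose proof (exp_pos 1) as He. assert (Hd : 0 < eps / exp 1) by now apply Rdiv_lt_0_compat.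
  exists (Rmin 1 (eps / exp 1)). split; [apply Rmin_pos; lra|]. intros w Hw.
  pose proof (Rmin_l 1 (eps / exp 1)). pose proof (Rmin_r 1 (eps / exp 1)).
  replace (w - 0)%C with w in * by ring. rewrite expq_0.
  destruct (Ceq_dec w 0) as [-> | Hw0].
  { rewrite expq_0. replace (1 - 1 - 0 * / 2)%C with (RtoC 0) by ring. rewrite Cmod_0. lra. }
  apply Cmod_gt_0 in Hw0 as Hm.
  apply Rmult_le_reg_l with (Cmod w); [exact Hm|]. rewrite <- Cmod_mult.
  replace (w * (expq w - 1 - w * / 2))%C with (Cexp_rem 3 w)
    by (rewrite Cexp_rem_3, (Cexp_expq w); field).
  eapply Rle_trans; [apply Cexp_rem_bound|].
  assert (Hexp : exp (Cmod w) <= exp 1) by (apply exp_le_compat; lra).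
  assert (Hwe : Cmod w * exp 1 <= eps) by (apply Rle_div_r; lra).
  assert (Cmod w * exp (Cmod w) <= eps) by nra.
  replace (Cmod w ^ 3 * exp (Cmod w)) with (Cmod w * (Cmod w * exp (Cmod w) * Cmod w)) by ring.
  apply Rmult_le_compat_l; [lra|]. apply Rmult_le_compat_r; lra.
Qed.

Lemma C_holo_at_Cexp (z : C) : C_holo_at Cexp z.
Proof.
  apply C_holo_at_ext with (fun w => Cexp z * (1 + (w - z) * expq (w - z)))%C.
  - intros w. rewrite <- Cexp_expq, <- Cexp_plus. f_equal. ring.
  - holo. apply (C_holo_at_comp expq (fun w => w - z)%C); [|holo].
    replace (z - z)%C with (RtoC 0) by ring. exact C_holo_at_expq_0.
Qed.

Lemma C_holo_at_expq (z : C) : C_holo_at expq z.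
Proof.
  destruct (Ceq_dec z 0) as [-> | Hz]; [exact C_holo_at_expq_0|].
  apply C_holo_at_ext_loc with (fun w => (Cexp w - 1) / w)%C (Cmod z); [now apply Cmod_gt_0| |].
  - intros w Hw. unfold expq. destruct (Ceq_dec w 0) as [-> |]; [|easy].
    rewrite Cmod_minus_sym in Hw. replace (z - 0)%C with z in Hw by ring. lra.
  - apply C_holo_at_div; [|apply C_holo_at_id | exact Hz].
    apply C_holo_at_minus; [apply C_holo_at_Cexp | apply C_holo_at_const].
Qed.

(** * Complex powers of positive reals *)

Definition Rcpow (x : R) (s : C) : C := Cexp (s * ln x).

Lemma Rcpow_plus (x : R) (s t : C) : Rcpow x (s + t) = (Rcpow x s * Rcpow x t)%C.
Proof. unfold Rcpow. rewrite <- Cexp_plus. f_equal. ring. Qed.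

Lemma Rcpow_mult (x y : R) (s : C) : 0 < x -> 0 < y ->
  Rcpow (x * y) s = (Rcpow x s * Rcpow y s)%C.
Proof.
  intros Hx Hy. unfold Rcpow. rewrite <- Cexp_plus, ln_mult, RtoC_plus by assumption.
  f_equal. ring.
Qed.

Lemma Rcpow_RtoC (x y : R) : Rcpow x (RtoC y) = RtoC (Rpower x y).
Proof. unfold Rcpow. now rewrite <- RtoC_mult, Cexp_RtoC. Qed.

Lemma Rcpow_0 (x : R) : Rcpow x 0 = 1.
Proof. unfold Rcpow. now rewrite Cmult_0_l, Cexp_0. Qed.

Lemma Rcpow_1_l (s : C) : Rcpow 1 s = 1.
Proof. unfold Rcpow. now rewrite ln_1, Cmult_0_r, Cexp_0. Qed.

Lemma Cmod_Rcpow (x : R) (s : C) : Cmod (Rcpow x s) = Rpower x (Re s).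
Proof. unfold Rcpow. rewrite Cmod_Cexp. unfold Rpower. f_equal. destruct s; simpl; ring. Qed.

Lemma C_holo_at_Rcpow (x : R) (s : C) : C_holo_at (Rcpow x) s.
Proof. apply (C_holo_at_comp Cexp (fun w => w * ln x)%C); [apply C_holo_at_Cexp | holo]. Qed.

Lemma ln_ge_0 (x : R) : 1 <= x -> 0 <= ln x.
Proof. intros Hx. rewrite <- ln_1. apply ln_le; lra. Qed.

Lemma lip_bounded_Rcpow (x r : R) (s : C) : 1 <= x -> 0 < r ->
  lip_bounded (Rcpow x) s r ((1 + ln x) * Rpower x (Re s + r)).
Proof.
  intros Hx%ln_ge_0 Hr w Hw. unfold Rpower. rewrite Cmod_Rcpow. unfold Rpower, Rcpow.
  set (l := ln x) in *. pose proof (exp_pos ((Re s + r) * l)) as Hpos.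
  assert (Hbound : exp (Re w * l) <= exp ((Re s + r) * l)).
  { apply exp_le_compat. apply Re_close in Hw. nra. }
  split; [nra|].
  replace (Cexp (w * l) - Cexp (s * l))%C with (Cexp (s * l) * Cexp_rem 1 ((w - s) * l))%C.
  2:{ replace (w * l)%C with (s * l + (w - s) * l)%C by ring.
      rewrite Cexp_plus, Cexp_rem_1. ring. }
  rewrite Cmod_mult, Cmod_Cexp.
  pose proof (Cexp_rem_bound 1 ((w - s) * l)) as Hrem.
  rewrite pow_1, Cmod_mult, Cmod_R, (Rabs_pos_eq l Hx) in Hrem.
  pose proof (Cmod_ge_0 (w - s)) as Hd. set (d := Cmod (w - s)) in *.
  assert (Hexp : exp (Re (s * l)%C) * exp (d * l) <= exp ((Re s + r) * l)).
  { rewrite <- exp_plus. apply exp_le_compat.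
    replace (Re (s * l)%C) with (Re s * l) by (destruct s; simpl; ring). nra. }
  apply Rle_trans with (exp (Re (s * l)%C) * (d * l * exp (d * l))).
  - apply Rmult_le_compat_l; [left; apply exp_pos | exact Hrem].
  - assert (0 <= d * l) by now apply Rmult_le_pos. nra.
Qed.

(** * Remainders of the binomial series *)

(* ((1 + x)^e - 1) / e, continued by ln (1 + x) at e = 0. *)
Definition binom_quot (e : C) (x : R) : C := (ln (1 + x) * expq (e * ln (1 + x)))%C.

Lemma mult_binom_quot (e : C) (x : R) : (e * binom_quot e x)%C = (Rcpow (1 + x) e - 1)%C.
Proof. unfold binom_quot, Rcpow. rewrite Cexp_expq. ring. Qed.

Lemma is_derive_binom_quot (e : C) (x : R) : 0 <= x ->
  is_derive_RC (binom_quot e) x (Rcpow (1 + x) (e - 1)).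
Proof.
  intros Hx.
  assert (Hln : is_derive (fun y => ln (1 + y)) x (/ (1 + x)))
    by (auto_derive; [lra | field; lra]).
  assert (Hpow : Rcpow (1 + x) (e - 1) = (Rcpow (1 + x) e * RtoC (/ (1 + x)))%C).
  { unfold Cminus. rewrite Rcpow_plus, <- RtoC_opp, Rcpow_RtoC.
    now rewrite Rpower_Ropp, Rpower_1 by lra. }
  destruct (Ceq_dec e 0) as [-> | He].
  - apply is_derive_RC_ext with (fun y => RtoC (ln (1 + y))).
    + intros y. unfold binom_quot. rewrite Cmult_0_l, expq_0. ring.
    + rewrite Hpow, Rcpow_0, Cmult_1_l. now apply is_derive_RC_RtoC.
  - apply is_derive_RC_ext with (fun y => / e * (Rcpow (1 + y) e - 1))%C.
    + intros y. rewrite <- mult_binom_quot. field. exact He.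
    + replace (Rcpow (1 + x) (e - 1))
        with (/ e * (e * RtoC (/ (1 + x)) * Rcpow (1 + x) e - 0))%C
        by (rewrite Hpow; field; exact He).
      apply is_derive_RC_scal.
      apply (is_derive_RC_minus (fun y => Rcpow (1 + y) e) (fun _ => RtoC 1)).
      * exact (is_derive_RC_Cexp e (fun y => ln (1 + y)) x _ Hln).
      * exact (is_derive_const _ _).
Qed.

(* binom(e, j + 1) / e *)
Fixpoint binom_div (j : nat) (e : C) : C :=
  match j with
  | O => 1
  | S i => (binom_div i e * (e - INR (S i)) / INR (S (S i)))%C
  end.

Lemma binom_div_S (j : nat) (e : C) :
  binom_div (S j) e = (binom_div j e * (e - INR (S j)) / INR (S (S j)))%C.
Proof. reflexivity. Qed.

Lemma binom_div_absorption (j : nat) (e : C) :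
  (INR (S (S j)) * binom_div (S j) e = (e - 1) * binom_div j (e - 1))%C.
Proof.
  induction j as [|j IH].
  - rewrite binom_div_S. pose proof (RtoC_INR_S_neq_0 1). simpl binom_div.
    change (INR 1) with 1. field. assumption.
  - rewrite binom_div_S, (binom_div_S j (e - 1)).
    pose proof (RtoC_INR_S_neq_0 (S j)). pose proof (RtoC_INR_S_neq_0 (S (S j))).
    transitivity ((INR (S (S j)) * binom_div (S j) e) * (e - INR (S (S j))) / INR (S (S j)))%C.
    + field. now split.
    + rewrite IH. rewrite (RtoC_INR_S (S j)) at 1. field. assumption.
Qed.

Lemma C_holo_at_binom_div (j : nat) (e : C) : C_holo_at (binom_div j) e.
Proof.
  induction j as [|j IH]; [apply C_holo_at_const|].
  apply C_holo_at_ext with (fun w => binom_div j w * (w - INR (S j)) / INR (S (S j)))%C;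
    [reflexivity|].
  holo. apply RtoC_INR_S_neq_0.
Qed.

(* The terms of order above m in the expansion of ((1 + x)^e - 1) / e in powers of x. *)
Fixpoint binom_rem (m : nat) (e : C) (x : R) : C :=
  match m with
  | O => binom_quot e x
  | S i => (binom_rem i e x - binom_div i e * RtoC (x ^ S i))%C
  end.

Lemma binom_rem_S (m : nat) (e : C) (x : R) :
  binom_rem (S m) e x = (binom_rem m e x - binom_div m e * RtoC (x ^ S m))%C.
Proof. reflexivity. Qed.

Lemma is_derive_binom_rem (m : nat) (e : C) (x : R) : 0 <= x ->
  is_derive_RC (binom_rem (S m) e) x ((e - 1) * binom_rem m (e - 1) x)%C.
Proof.
  intros Hx.
  assert (Hpow : forall n, is_derive_RC (fun y => binom_div n e * RtoC (y ^ S n))%C x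
                             (binom_div n e * RtoC (INR (S n) * x ^ n))%C).
  { intros n. apply is_derive_RC_scal, is_derive_RC_RtoC.
    apply is_derive_Reals, (derivable_pt_lim_pow x (S n)). }
  induction m as [|m IH].
  - simpl (binom_rem 0). rewrite mult_binom_quot.
    replace (Rcpow (1 + x) (e - 1) - 1)%C
      with (Rcpow (1 + x) (e - 1) - binom_div 0 e * RtoC (INR 1 * x ^ 0))%C
      by (simpl; rewrite Rmult_1_l; ring).
    apply (is_derive_RC_minus (binom_quot e)); [now apply is_derive_binom_quot | apply Hpow].
  - replace ((e - 1) * binom_rem (S m) (e - 1) x)%C
      with ((e - 1) * binom_rem m (e - 1) x
            - binom_div (S m) e * RtoC (INR (S (S m)) * x ^ S m))%C.
    + apply (is_derive_RC_minus (binom_rem (S m) e)); [exact IH | apply Hpow].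
    + rewrite binom_rem_S, RtoC_mult.
      transitivity ((e - 1) * binom_rem m (e - 1) x
                    - (INR (S (S m)) * binom_div (S m) e) * RtoC (x ^ S m))%C; [ring|].
      rewrite binom_div_absorption. ring.
Qed.

Lemma binom_rem_0_r (m : nat) (e : C) : binom_rem m e 0 = 0.
Proof.
  induction m as [|m IH].
  - simpl. unfold binom_quot. rewrite Rplus_0_r, ln_1. ring.
  - rewrite binom_rem_S, IH, pow_i by lia. ring.
Qed.

Lemma C_holo_at_binom_rem (m : nat) (e : C) (x : R) : C_holo_at (fun w => binom_rem m w x) e.
Proof.
  induction m as [|m IH].
  - simpl. apply C_holo_at_mult; [apply C_holo_at_const|].
    apply (C_holo_at_comp expq (fun w => w * ln (1 + x))%C); [apply C_holo_at_expq | holo].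
  - apply (C_holo_at_minus (fun w => binom_rem m w x)); [exact IH|].
    apply C_holo_at_mult; [apply C_holo_at_binom_div | apply C_holo_at_const].
Qed.

Lemma lip_bounded_Rcpow_1p (e : C) (x : R) : 0 <= x <= 1 ->
  lip_bounded (Rcpow (1 + x)) e 1 (2 * exp (Rabs (Re e + 1))).
Proof.
  intros Hx. apply lip_bounded_le with (3 := lip_bounded_Rcpow (1 + x) 1 e ltac:(lra) Rlt_0_1);
    [apply Rle_refl|].
  pose proof (ln_ge_0 (1 + x) ltac:(lra)) as Hln.
  assert (Hln1 : ln (1 + x) <= 1).
  { rewrite <- (ln_exp 1) at 2. apply ln_le; [lra|]. pose proof (exp_ineq1_le 1). lra. }
  apply Rmult_le_compat; [lra | left; apply exp_pos | lra|].
  apply exp_le_compat. pose proof (Rle_abs (Re e + 1)). pose proof (Rabs_pos (Re e + 1)). nra.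
Qed.

Lemma lip_bounded_binom_rem (m : nat) (e : C) : exists B, 0 <= B /\
  forall x, 0 <= x <= 1 -> lip_bounded (fun w => binom_rem m w x) e 1 (B * x ^ S m).
Proof.
  assert (Hshift : forall w v : C, Cmod (w - 1 - (v - 1)) = Cmod (w - v))
    by (intros; f_equal; ring).
  revert e. induction m as [|m IH]; intros e.
  - set (B := 2 * exp (Rabs (Re (e - 1)%C + 1))).
    exists B. split; [unfold B; pose proof (exp_pos (Rabs (Re (e - 1)%C + 1))); lra|].
    intros x Hx. rewrite pow_1.
    apply (lip_bounded_of_derive binom_quot (fun w y => Rcpow (1 + y) (w - 1))); [easy | | |].
    + exact (binom_rem_0_r 0).
    + intros w y Hy. now apply is_derive_binom_quot.
    + intros y Hy. apply (lip_bounded_isometry (Rcpow (1 + y)) (fun w => w - 1)%C); [easy|].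
      apply lip_bounded_Rcpow_1p. lra.
  - destruct (IH (e - 1)%C) as [B [HB HL]].
    pose proof (Cmod_ge_0 e). pose proof (Cmod_ge_0 1). set (A := Cmod e + Cmod 1 + 1 + 1).
    assert (HAB : 0 <= 2 * A * B) by (unfold A; repeat apply Rmult_le_pos; lra).
    exists (2 * A * B). split; [exact HAB|]. intros x Hx.
    replace (2 * A * B * x ^ S (S m)) with (2 * A * (B * x ^ S m) * x) by (simpl; ring).
    apply (lip_bounded_of_derive (binom_rem (S m)) (fun w y => (w - 1) * binom_rem m (w - 1) y)%C);
      [easy | exact (binom_rem_0_r (S m)) | |].
    + intros w y Hy. now apply is_derive_binom_rem.
    + intros y Hy.
      apply (lip_bounded_mult (fun w => w - 1)%C); [lra | apply lip_bounded_minus_const|].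
      apply (lip_bounded_isometry (fun w => binom_rem m w y) (fun w => w - 1)%C); [easy|].
      apply lip_bounded_le with (3 := HL y ltac:(lra)); [apply Rle_refl|].
      apply Rmult_le_compat_l; [exact HB|]. apply pow_incr. lra.
Qed.

(** * Dirichlet series *)

Lemma Rpower_pos (x y : R) : 0 < Rpower x y.
Proof. apply exp_pos. Qed.

Lemma pow_inv_Rpower (x : R) (n : nat) : 0 < x -> (/ x) ^ n = Rpower x (- INR n).
Proof. intros Hx. now rewrite Rpower_Ropp, Rpower_pow, pow_inv. Qed.

Lemma is_lim_seq_Rpower_neg (b : R) : 0 < b ->
  is_lim_seq (fun k => Rpower (INR (S k)) (- b)) 0.
Proof.
  intros Hb. apply is_lim_seq_spec. intros eps. pose proof (cond_pos eps) as Heps.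
  set (y := Rpower eps (- / b)).
  destruct (INR_unbounded y) as [N HN]. exists N. intros n Hn.
  assert (Hyn : y < INR (S n)).
  { apply Rlt_trans with (1 := HN). apply lt_INR. lia. }
  rewrite Rminus_0_r, Rabs_pos_eq by (left; apply Rpower_pos).
  pose proof (Rlt_Rpower_l y (INR (S n)) b Hb (conj (Rpower_pos _ _) Hyn)) as Hpow.
  unfold y in Hpow. rewrite Rpower_mult in Hpow.
  replace (- / b * b) with (- (1)) in Hpow by (field; lra).
  rewrite Rpower_Ropp, Rpower_1 in Hpow by easy. rewrite Rpower_Ropp.
  rewrite <- (Rinv_inv eps). apply Rinv_lt_contravar; [|exact Hpow].
  apply Rmult_lt_0_compat; [now apply Rinv_0_lt_compat | apply Rpower_pos].
Qed.

Lemma ln_incr_ge (x : R) : 1 < x -> / x <= ln x - ln (x - 1).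
Proof.
  intros Hx. rewrite <- ln_div by lra.
  rewrite <- (Ropp_involutive (ln _)), <- ln_Rinv by (apply Rdiv_lt_0_compat; lra).
  apply Ropp_le_cancel. rewrite Ropp_involutive, <- (ln_exp (- / x)).
  apply ln_le; [apply Rinv_0_lt_compat, Rdiv_lt_0_compat; lra|].
  pose proof (exp_ineq1_le (- / x)). replace (/ (x / (x - 1))) with (1 + - / x); [easy|].
  field. lra.
Qed.

Lemma Rpower_decr_ge (b x : R) : 0 < b -> 1 < x ->
  b * Rpower x (- (b + 1)) <= Rpower (x - 1) (- b) - Rpower x (- b).
Proof.
  intros Hb Hx. replace (- (b + 1)) with (- b + - (1)) by ring.
  rewrite Rpower_plus, (Rpower_Ropp x 1), (Rpower_1 x) by lra.
  assert (E : Rpower (x - 1) (- b) = Rpower x (- b) * exp (b * (ln x - ln (x - 1)))).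
  { unfold Rpower. rewrite <- exp_plus. f_equal. ring. }
  rewrite E. pose proof (Rpower_pos x (- b)).
  pose proof (exp_ineq1_le (b * (ln x - ln (x - 1)))).
  pose proof (Rmult_le_compat_l b _ _ ltac:(lra) (ln_incr_ge x Hx)).
  nra.
Qed.

Lemma ex_series_Rpower (a : R) : 1 < a -> ex_series (fun k => Rpower (INR (S k)) (- a)).
Proof.
  intros Ha. apply ex_series_incr_1. set (b := a - 1). assert (Hb : 0 < b) by (unfold b; lra).
  set (u := fun k => Rpower (INR (S k)) (- b)).
  apply (ex_series_le (fun k => Rpower (INR (S (S k))) (- a)) (fun k => - / b * (u (S k) - u k))).
  - intros k. change (Rabs (Rpower (INR (S (S k))) (- a)) <= - / b * (u (S k) - u k)).
    rewrite Rabs_pos_eq by (left; apply Rpower_pos).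
    pose proof (INR_S_ge_1 k).
    pose proof (Rpower_decr_ge b (INR (S (S k))) Hb ltac:(rewrite (S_INR (S k)); lra)) as Hdec.
    replace (INR (S (S k)) - 1) with (INR (S k)) in Hdec by (rewrite (S_INR (S k)); ring).
    replace (- (b + 1)) with (- a) in Hdec by (unfold b; ring).
    apply Rmult_le_reg_l with b; [easy|]. unfold u.
    replace (b * (- / b * (Rpower (INR (S (S k))) (- b) - Rpower (INR (S k)) (- b))))
      with (Rpower (INR (S k)) (- b) - Rpower (INR (S (S k))) (- b)) by (field; lra). exact Hdec.
  - apply (ex_series_scal_l (- / b) (fun k => u (S k) - u k)). eexists.
    apply (is_series_telescope u 0). now apply is_lim_seq_Rpower_neg.
Qed.

Lemma Cnpow_plus (n : nat) (s t : C) : Cnpow n (s + t) = (Cnpow n s * Cnpow n t)%C.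
Proof. apply Rcpow_plus. Qed.

Lemma Cnpow_opp_INR (n m : nat) : Cnpow (S n) (- INR m) = RtoC ((/ INR (S n)) ^ m).
Proof.
  pose proof (INR_S_ge_1 n). rewrite pow_inv_Rpower by lra.
  rewrite <- RtoC_opp. apply Rcpow_RtoC.
Qed.

Lemma lip_bounded_Cnpow (n : nat) (s : C) (eps : R) : 0 < eps <= 1 ->
  lip_bounded (Cnpow (S n)) s eps (/ eps * Rpower (INR (S n)) (Re s + 2 * eps)).
Proof.
  intros Heps. pose proof (INR_S_ge_1 n) as Hn. set (x := INR (S n)) in *.
  apply lip_bounded_le with (3 := lip_bounded_Rcpow x eps s Hn ltac:(lra)); [apply Rle_refl|].
  replace (Re s + 2 * eps) with (eps + (Re s + eps)) by ring.
  rewrite (Rpower_plus eps), <- Rmult_assoc.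
  apply Rmult_le_compat_r; [left; apply Rpower_pos|].
  apply Rmult_le_reg_l with eps; [lra|]. rewrite <- Rmult_assoc, Rinv_r, Rmult_1_l by lra.
  unfold Rpower. pose proof (exp_ineq1_le (eps * ln x)). lra.
Qed.

Lemma locally_dominated_Cnpow_mult (a : C -> C) (g : nat -> C -> C) (z : C) (r B b : R) (N : nat) :
  (forall w, Cmod (a w - a z) = Cmod (w - z)) -> 0 < r -> Re (a z) + 1 < b ->
  (forall n, (N <= n)%nat -> lip_bounded (g n) z r (B * Rpower (INR (S n)) (- b))) ->
  locally_dominated (fun n w => Cnpow (S n) (a w) * g n w)%C z.
Proof.
  intros Ha Hr Hb Hg. set (d := b - Re (a z) - 1). assert (Hd : 0 < d) by (unfold d; lra).
  set (eps := Rmin (Rmin 1 r) (d / 3)).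
  assert (Heps : 0 < eps) by (repeat apply Rmin_pos; lra).
  assert (Hepsd : eps <= d / 3) by apply Rmin_r.
  assert (Heps1r : eps <= Rmin 1 r) by apply Rmin_l.
  pose proof (Rmin_l 1 r). pose proof (Rmin_r 1 r).
  exists eps, (fun n => 2 * / eps * B * Rpower (INR (S n)) (- (1 + d - 2 * eps))), N.
  split; [exact Heps|]. split.
  - apply (ex_series_scal_l (2 * / eps * B)
      (fun n => Rpower (INR (S n)) (- (1 + d - 2 * eps)))), ex_series_Rpower. lra.
  - intros n Hn.
    replace (- (1 + d - 2 * eps)) with (Re (a z) + 2 * eps + - b) by (unfold d; ring).
    rewrite Rpower_plus.
    replace (2 * / eps * B * (Rpower (INR (S n)) (Re (a z) + 2 * eps) * Rpower (INR (S n)) (- b)))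
      with (2 * (/ eps * Rpower (INR (S n)) (Re (a z) + 2 * eps)) * (B * Rpower (INR (S n)) (- b)))
      by ring.
    apply (lip_bounded_mult (fun w => Cnpow (S n) (a w))); [exact Heps | |].
    + apply (lip_bounded_isometry (Cnpow (S n)) a); [exact Ha|]. apply lip_bounded_Cnpow. lra.
    + apply lip_bounded_le with (3 := Hg n Hn); [lra | apply Rle_refl].
Qed.

(** * Gluing along half-planes *)

Definition glue (h : C -> R) (F : nat -> C -> C) (z : C) : C := F (Z.to_nat (up (h z))) z.

Lemma INR_up_gt (x : R) : x < INR (Z.to_nat (up x)).
Proof.
  destruct (archimed x) as [Hup _]. rewrite INR_IZR_INZ.
  apply Rlt_le_trans with (1 := Hup), IZR_le. lia.
Qed.

Lemma glue_eq (h : C -> R) (F : nat -> C -> C) (z : C) (p : nat) :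
  (forall q, h z < INR q -> F (S q) z = F q z) -> h z < INR p -> glue h F z = F p z.
Proof.
  intros HF Hp.
  assert (Hle : forall q r, (q <= r)%nat -> h z < INR q -> F r z = F q z).
  { intros q r Hqr Hq. induction Hqr as [|r Hqr IH]; [easy|]. rewrite HF; [exact IH|].
    apply Rlt_le_trans with (1 := Hq). now apply le_INR. }
  unfold glue. pose proof (INR_up_gt (h z)) as Hup.
  destruct (Nat.le_ge_cases p (Z.to_nat (up (h z)))); [|symmetry]; now apply Hle.
Qed.

Lemma C_holo_at_glue (h : C -> R) (F : nat -> C -> C) (z : C) :
  (forall w, h w - h z <= Cmod (w - z)) ->
  (forall w q, h w < INR q -> F (S q) w = F q w) ->
  (forall p, h z < INR p -> C_holo_at (F p) z) -> C_holo_at (glue h F) z.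
Proof.
  intros Hh HF Hhol. destruct (INR_unbounded (h z + 1)) as [p Hp].
  apply C_holo_at_ext_loc with (F p) 1; [lra | | apply Hhol; lra].
  intros w Hw. symmetry. apply glue_eq; [apply HF|]. specialize (Hh w). lra.
Qed.

(** * The zeta function *)

Definition zeta (s : C) : C := CSeries (fun k => Cnpow (S k) (- s)).

Lemma ex_series_zeta (s : C) : 1 < Re s -> ex_series_C (fun k => Cnpow (S k) (- s)).
Proof.
  intros Hs. apply ex_series_C_le with (fun k => Rpower (INR (S k)) (- Re s)).
  - intros k. right. apply Cmod_Rcpow.
  - now apply ex_series_Rpower.
Qed.

Definition binom_rem_term (m k : nat) (s : C) : C :=
  (Cnpow (S k) (1 - s) * binom_rem m (1 - s) (/ INR (S k)))%C.

Definition binom_rem_series (m : nat) (s : C) : C := CSeries (fun k => binom_rem_term m k s).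

Lemma locally_dominated_binom_rem_term (m : nat) (s : C) :
  1 - INR m < Re s -> locally_dominated (binom_rem_term m) s.
Proof.
  intros Hs. destruct (lip_bounded_binom_rem m (1 - s)) as [B [HB HL]].
  assert (Hiso : forall w, Cmod (1 - w - (1 - s)) = Cmod (w - s))
    by (intros w; rewrite Cmod_minus_sym; f_equal; ring).
  apply (locally_dominated_Cnpow_mult (fun w => 1 - w)%C
    (fun k w => binom_rem m (1 - w) (/ INR (S k))) s 1 B (INR (S m)) 0 Hiso Rlt_0_1).
  - change (Re (1 - s)%C) with (1 - Re s). rewrite S_INR. lra.
  - intros k _. pose proof (INR_S_ge_1 k).
    rewrite <- pow_inv_Rpower by lra.
    apply (lip_bounded_isometry (fun e => binom_rem m e (/ INR (S k)))
      (fun w => 1 - w)%C _ _ _ Hiso).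
    apply HL. split; [left; apply Rinv_0_lt_compat; lra|].
    rewrite <- Rinv_1. apply Rinv_le_contravar; lra.
Qed.

Lemma ex_series_binom_rem_term (m : nat) (s : C) :
  1 - INR m < Re s -> ex_series_C (fun k => binom_rem_term m k s).
Proof.
  intros Hs. now apply locally_dominated_ex_series, locally_dominated_binom_rem_term.
Qed.

Lemma C_holo_at_binom_rem_series (m : nat) (s : C) :
  1 - INR m < Re s -> C_holo_at (binom_rem_series m) s.
Proof.
  intros Hs. apply C_holo_at_CSeries; [now apply locally_dominated_binom_rem_term|].
  intros k. apply C_holo_at_mult.
  - apply (C_holo_at_comp (Cnpow (S k)) (fun w => 1 - w)%C); [apply C_holo_at_Rcpow | holo].
  - apply (C_holo_at_comp (fun e => binom_rem m e (/ INR (S k))) (fun w => 1 - w)%C);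
      [apply C_holo_at_binom_rem | holo].
Qed.

Lemma binom_rem_term_S (m k : nat) (s : C) :
  binom_rem_term (S m) k s
  = (binom_rem_term m k s - binom_div m (1 - s) * Cnpow (S k) (- (s + INR m)))%C.
Proof.
  unfold binom_rem_term. rewrite binom_rem_S, <- Cnpow_opp_INR.
  replace (- (s + INR m))%C with (1 - s + - INR (S m))%C by (rewrite RtoC_INR_S; ring).
  rewrite (Cnpow_plus (S k) (1 - s)). ring.
Qed.

Lemma binom_rem_series_S (m : nat) (s : C) : 1 - INR m < Re s ->
  binom_rem_series (S m) s = (binom_rem_series m s - binom_div m (1 - s) * zeta (s + INR m))%C.
Proof.
  intros Hs.
  assert (Hz : ex_series_C (fun k => Cnpow (S k) (- (s + INR m)))).
  { apply ex_series_zeta. change (Re (s + INR m)%C) with (Re s + INR m). lra. }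
  pose proof (ex_series_binom_rem_term m s Hs) as Hm.
  unfold binom_rem_series, zeta.
  rewrite (CSeries_ext _ _ (fun k => binom_rem_term_S m k s)), CSeries_minus, CSeries_scal;
    auto using ex_series_C_minus, ex_series_C_scal.
Qed.

Lemma binom_rem_term_0 (k : nat) (s : C) :
  ((1 - s) * binom_rem_term 0 k s = Cnpow (S (S k)) (1 - s) - Cnpow (S k) (1 - s))%C.
Proof.
  pose proof (INR_S_ge_1 k).
  assert (0 < / INR (S k)) by (apply Rinv_0_lt_compat; lra).
  assert (Hsucc : INR (S (S k)) = INR (S k) * (1 + / INR (S k)))
    by (rewrite (S_INR (S k)); field; lra).
  unfold binom_rem_term.
  replace (Cnpow (S (S k)) (1 - s)) with (Cnpow (S k) (1 - s) * Rcpow (1 + / INR (S k)) (1 - s))%C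
    by (change (Cnpow (S (S k))) with (Rcpow (INR (S (S k)))); rewrite Hsucc, Rcpow_mult by lra;
        reflexivity).
  transitivity (Cnpow (S k) (1 - s) * ((1 - s) * binom_quot (1 - s) (/ INR (S k))))%C;
    [simpl; ring | rewrite mult_binom_quot; ring].
Qed.

Lemma is_series_Cnpow_telescope (s : C) : 1 < Re s ->
  is_series_C (fun k => Cnpow (S (S k)) (1 - s) - Cnpow (S k) (1 - s))%C (- (1))%C.
Proof.
  intros Hs. set (u := fun k => Cnpow (S k) (1 - s)).
  replace (- (1))%C with (0 - u 0%nat)%C.
  2:{ unfold u. change (Cnpow 1) with (Rcpow 1). rewrite Rcpow_1_l. ring. }
  apply (is_series_telescope (V := C_NormedModule) u).
  apply (filterlim_norm_zero (V := C_NormedModule)).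
  apply filterlim_ext with (fun k => Rpower (INR (S k)) (- (Re s - 1))).
  - intros k. symmetry. unfold u. etransitivity; [apply (Cmod_Rcpow (INR (S k)))|].
    f_equal. change (Re (1 - s)%C) with (1 - Re s). ring.
  - apply is_lim_seq_Rpower_neg. lra.
Qed.

Lemma zeta_eq_binom_rem_series (s : C) : 1 < Re s ->
  zeta s = (/ (s - 1) - binom_rem_series 1 s)%C.
Proof.
  intros Hs.
  assert (Hs0 : (s - 1)%C <> 0).
  { apply Re_neq_0. change (Re (s - 1)%C) with (Re s - 1). lra. }
  assert (H1s : (1 - s)%C <> 0).
  { apply Re_neq_0. change (Re (1 - s)%C) with (1 - Re s). lra. }
  pose proof (ex_series_zeta s Hs) as Hz.
  assert (Hrem : ex_series_C (fun k => binom_rem_term 1 k s))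
    by (apply ex_series_binom_rem_term; simpl; lra).
  assert (Hterm : forall k, (Cnpow (S (S k)) (1 - s) - Cnpow (S k) (1 - s)
    = (1 - s) * (binom_rem_term 1 k s + Cnpow (S k) (- s)))%C).
  { intros k. rewrite <- binom_rem_term_0, binom_rem_term_S. simpl binom_div.
    replace (s + INR 0)%C with s by (simpl; ring). ring. }
  assert (Hsum : ((1 - s) * (binom_rem_series 1 s + zeta s) = - (1))%C).
  { unfold binom_rem_series, zeta.
    rewrite <- CSeries_plus, <- CSeries_scal by auto using ex_series_C_plus.
    apply is_series_C_unique.
    now apply is_series_ext with (1 := Hterm), is_series_Cnpow_telescope. }
  replace (zeta s)
    with ((1 - s) * (binom_rem_series 1 s + zeta s) / (1 - s) - binom_rem_series 1 s)%C
    by (field; exact H1s).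
  rewrite Hsum. field. now split.
Qed.

Definition zeta_regular_part (Z : C -> C) : Prop :=
  forall s, 1 < Re s -> zeta s = (/ (s - 1) + Z s)%C.

(* [binom_rem_series (m + 2) s] is [binom_rem_series 1 s] minus multiples of zeta (s + 1), ...,
   zeta (s + m + 1).  Here these values are replaced by 1 / (s + j) + Z (s + j + 1), and the
   first summand is cancelled against the last factor of [binom_div]. *)
Definition shift_expansion (m : nat) (Z : C -> C) (s : C) : C :=
  (sum_n (fun j => binom_div j (1 - s) / INR (S (S j))
                   - binom_div (S j) (1 - s) * Z (s + INR (S j))) m
   - binom_rem_series (S (S m)) s)%C.

Lemma shift_expansion_ext (m : nat) (Z W : C -> C) (s : C) :
  (forall j, Z (s + INR (S j))%C = W (s + INR (S j))%C) ->
  shift_expansion m Z s = shift_expansion m W s.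
Proof.
  intros HZW. unfold shift_expansion. f_equal. apply sum_n_ext. intros j. now rewrite HZW.
Qed.

Lemma C_holo_at_shift_expansion (m : nat) (Z : C -> C) (s : C) : - INR (S m) < Re s ->
  (forall j, (j <= m)%nat -> C_holo_at Z (s + INR (S j))%C) -> C_holo_at (shift_expansion m Z) s.
Proof.
  intros Hs HZ. apply C_holo_at_minus.
  - apply (C_holo_at_sum_n (fun j w => binom_div j (1 - w) / INR (S (S j))
      - binom_div (S j) (1 - w) * Z (w + INR (S j)))%C).
    intros j Hj.
    assert (Hdiv : forall i, C_holo_at (fun w => binom_div i (1 - w)) s)
      by (intros i; apply (C_holo_at_comp (binom_div i) (fun w => 1 - w)%C);
          [apply C_holo_at_binom_div | holo]).
    apply C_holo_at_minus.
    + apply C_holo_at_div; [apply Hdiv | apply C_holo_at_const | apply RtoC_INR_S_neq_0].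
    + apply C_holo_at_mult; [apply Hdiv|].
      apply (C_holo_at_comp Z (fun w => w + INR (S j))%C); [now apply HZ | holo].
  - apply C_holo_at_binom_rem_series. rewrite S_INR. lra.
Qed.

Section ShiftExpansion.

Variable Z : C -> C.
Hypothesis HZ : zeta_regular_part Z.

Lemma shift_expansion_last (m : nat) (s : C) : - INR m < Re s ->
  (binom_div m (1 - s) / INR (S (S m)) - binom_div (S m) (1 - s) * Z (s + INR (S m))
   - binom_rem_series (S (S m)) s = - binom_rem_series (S m) s)%C.
Proof.
  intros Hs. assert (Hre : Re (s + INR (S m))%C = Re s + INR m + 1)
    by (change (Re (s + INR (S m))%C) with (Re s + INR (S m)); rewrite S_INR; ring).
  rewrite binom_rem_series_S by (rewrite S_INR; lra).
  rewrite (HZ (s + INR (S m))%C), binom_div_S by lra.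
  pose proof (RtoC_INR_S_neq_0 (S m)).
  assert ((s + INR (S m) - 1)%C <> 0).
  { apply Re_neq_0. change (Re (s + INR (S m) - 1)%C) with (Re (s + INR (S m))%C - 1). lra. }
  field. now split.
Qed.

Lemma shift_expansion_0 (s : C) : 0 < Re s -> shift_expansion 0 Z s = (- binom_rem_series 1 s)%C.
Proof.
  intros Hs. unfold shift_expansion. rewrite sum_O. apply shift_expansion_last. simpl. lra.
Qed.

Lemma shift_expansion_S (m : nat) (s : C) : - INR (S m) < Re s ->
  shift_expansion (S m) Z s = shift_expansion m Z s.
Proof.
  intros Hs. unfold shift_expansion at 1. rewrite sum_Sn.
  match goal with |- (plus ?A ?B - ?D = _)%C =>
    change (A + B - D = shift_expansion m Z s)%C;
    replace (A + B - D)%C with (A + (B - D))%C by ring end.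
  rewrite shift_expansion_last by exact Hs. reflexivity.
Qed.

Lemma shift_expansion_regular (m : nat) : zeta_regular_part (shift_expansion m Z).
Proof.
  intros s Hs. rewrite zeta_eq_binom_rem_series by exact Hs.
  replace (shift_expansion m Z s) with (- binom_rem_series 1 s)%C; [ring|].
  induction m as [|m IH]; [symmetry; apply shift_expansion_0; lra|].
  rewrite shift_expansion_S; [exact IH|]. pose proof (pos_INR (S m)). lra.
Qed.

End ShiftExpansion.

Fixpoint zeta_reg_upto (p : nat) : C -> C :=
  match p with
  | O => fun s => (- binom_rem_series 1 s)%C
  | S q => shift_expansion q (zeta_reg_upto q)
  end.

Lemma zeta_reg_upto_regular (p : nat) : zeta_regular_part (zeta_reg_upto p).
Proof.
  destruct p as [|p]; [intros s Hs; now apply zeta_eq_binom_rem_series|].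
  induction p as [|p IH]; apply shift_expansion_regular; [|exact IH].
  intros s Hs. now apply zeta_eq_binom_rem_series.
Qed.

Lemma zeta_reg_upto_S (p : nat) (s : C) :
  - Re s < INR p -> zeta_reg_upto (S p) s = zeta_reg_upto p s.
Proof.
  revert s. induction p as [|p IH]; intros s Hs.
  - apply shift_expansion_0; [apply (zeta_reg_upto_regular 0) | simpl in Hs; lra].
  - transitivity (shift_expansion p (zeta_reg_upto (S p)) s).
    + apply shift_expansion_S; [apply zeta_reg_upto_regular | lra].
    + apply shift_expansion_ext. intros j. apply IH.
      change (Re (s + INR (S j))%C) with (Re s + INR (S j)).
      rewrite S_INR in *. pose proof (pos_INR j). lra.
Qed.

Lemma C_holo_at_zeta_reg_upto (p : nat) (s : C) :
  - Re s < INR p -> C_holo_at (zeta_reg_upto p) s.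
Proof.
  revert s. induction p as [|p IH]; intros s Hs.
  - apply C_holo_at_opp, C_holo_at_binom_rem_series. simpl in *. lra.
  - apply C_holo_at_shift_expansion; [lra|]. intros j Hj. apply IH.
    change (Re (s + INR (S j))%C) with (Re s + INR (S j)).
    rewrite S_INR in *. pose proof (pos_INR j). lra.
Qed.

Definition zeta_reg : C -> C := glue (fun s => - Re s) zeta_reg_upto.

Lemma C_holo_at_zeta_reg (s : C) : C_holo_at zeta_reg s.
Proof.
  apply C_holo_at_glue; [| exact (fun w q => zeta_reg_upto_S q w) |
    exact (fun p => C_holo_at_zeta_reg_upto p s)].
  intros w. pose proof (re_le_Cmod (s - w)) as Hre. rewrite Cmod_minus_sym in Hre.
  pose proof (Rle_abs (Re (s - w)%C)). change (Re (s - w)%C) with (Re s - Re w) in *. lra.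
Qed.

Lemma zeta_reg_regular : zeta_regular_part zeta_reg.
Proof.
  intros s Hs. unfold zeta_reg. rewrite (glue_eq _ _ s 0).
  - now apply zeta_reg_upto_regular.
  - exact (fun q => zeta_reg_upto_S q s).
  - simpl. lra.
Qed.

(** * The terms of G *)

Definition G_expo (t : C) : C := (RtoC (- (1 / 2)) - Ci * t)%C.

Definition two_pi_sq (k : nat) : C := RtoC (2 * PI * INR (S k) ^ 2).

Definition zeta_arg (J : nat) (t : C) : C := (INR (2 * S J) - G_expo t)%C.

Definition zeta_coef (J : nat) (t : C) : C := (t / (2 * PI)%R * (- t / (2 * PI)%R) ^ J)%C.

(* The expansion of n^(-1/2 - it) u / (1 + u), with u = t / (2 pi n^2), has terms
   -(-u)^(J+1) n^(-1/2 - it) = zeta_coef J t * n^(- zeta_arg J t).  The recursive form of the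
   remainder satisfies the recurrence in K also at the pole u = -1, where the closed form
   [G_rem_term_closed] is broken by division by zero. *)
Fixpoint G_rem_term (K k : nat) (t : C) : C :=
  match K with
  | O => G_term t (S k)
  | S J => (G_rem_term J k t - zeta_coef J t * Cnpow (S k) (- zeta_arg J t))%C
  end.

Lemma G_rem_term_S (K k : nat) (t : C) :
  G_rem_term (S K) k t = (G_rem_term K k t - zeta_coef K t * Cnpow (S k) (- zeta_arg K t))%C.
Proof. reflexivity. Qed.

Lemma two_pi_neq_0 : RtoC (2 * PI) <> 0.
Proof. apply RtoC_neq_0. pose proof PI_RGT_0. lra. Qed.

Lemma Re_G_expo (t : C) : Re (G_expo t) = Im t - 1 / 2.
Proof. destruct t; simpl; lra. Qed.

Lemma Re_zeta_arg (J : nat) (t : C) : Re (zeta_arg J t) = 5 / 2 + 2 * INR J - Im t.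
Proof.
  change (INR (2 * S J) - Re (G_expo t) = 5 / 2 + 2 * INR J - Im t).
  rewrite Re_G_expo, mult_INR, (S_INR J). change (INR 2) with 2. lra.
Qed.

Lemma G_rem_term_closed (K k : nat) (t : C) : (two_pi_sq k + t)%C <> 0 ->
  G_rem_term K k t = (Cnpow (S k) (G_expo t) *
    (t * (- t / (2 * PI)%R) ^ K * (RtoC ((/ INR (S k)) ^ (2 * K)) * / (two_pi_sq k + t))))%C.
Proof.
  intros Ht. induction K as [|K IH].
  - simpl G_rem_term. unfold G_term. fold (two_pi_sq k) (G_expo t). simpl Cpow. simpl pow.
    field. exact Ht.
  - rewrite G_rem_term_S, IH.
    replace (- zeta_arg K t)%C with (G_expo t + - INR (2 * S K))%C by (unfold zeta_arg; ring).
    rewrite Cnpow_plus, Cnpow_opp_INR.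
    replace (2 * S K)%nat with (S (S (2 * K))) by lia. cbn [Cpow pow]. unfold zeta_coef.
    pose proof two_pi_neq_0 as H2pi. pose proof (RtoC_INR_S_neq_0 k) as Hn.
    pose proof (INR_S_ge_1 k).
    assert (Esq : two_pi_sq k = (RtoC (2 * PI) * (INR (S k) * INR (S k)))%C)
      by (unfold two_pi_sq; rewrite <- !RtoC_mult; f_equal; ring).
    rewrite Esq in *. rewrite !RtoC_mult, RtoC_inv by lra. rewrite <- (RtoC_mult 2 PI).
    field. now repeat split.
Qed.

Lemma two_pi_sq_plus_ge (t w : C) (k : nat) : Cmod t + 1 < INR (S k) -> Cmod (w - t) < 1 ->
  INR (S k) ^ 2 <= Cmod (two_pi_sq k + w).
Proof.
  intros Hk Hw. pose proof (INR_S_ge_1 k). pose proof PI2_1.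
  pose proof (Cmod_triangle_inv w t). pose proof (Cmod_triangle_inv (two_pi_sq k) (- w)) as Htri.
  unfold two_pi_sq in Htri at 1. rewrite Cmod_R, Rabs_pos_eq, Cmod_opp in Htri by nra.
  replace (two_pi_sq k - - w)%C with (two_pi_sq k + w)%C in Htri by ring. nra.
Qed.

Lemma Cmod_G_expo_minus (t w : C) : Cmod (G_expo w - G_expo t) = Cmod (w - t).
Proof.
  replace (G_expo w - G_expo t)%C with (- (Ci * (w - t)))%C by (unfold G_expo; ring).
  rewrite Cmod_opp, Cmod_mult, Cmod_Ci. ring.
Qed.

Lemma locally_dominated_G_rem_term (K : nat) (t : C) :
  Im t < 3 / 2 + 2 * INR K -> locally_dominated (G_rem_term K) t.
Proof.
  intros Ht. pose proof two_pi_neq_0.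
  destruct (C_holo_at_lip_bounded (fun w => w * (- w / (2 * PI)%R) ^ K)%C t) as [r [Q [Hr HQ]]];
    [now holo|].
  destruct (INR_unbounded (Cmod t + 1)) as [N HN].
  assert (Hlarge : forall k, (N <= k)%nat -> Cmod t + 1 < INR (S k)).
  { intros k Hk. apply Rlt_trans with (1 := HN). apply lt_INR. lia. }
  apply locally_dominated_ext with (r := 1) (N := N) (f := fun k w => (Cnpow (S k) (G_expo w) *
    (w * (- w / (2 * PI)%R) ^ K * (RtoC ((/ INR (S k)) ^ (2 * K)) * / (two_pi_sq k + w))))%C);
    [lra| |].
  - intros k w Hk Hw. symmetry. apply G_rem_term_closed, Cmod_gt_0.
    pose proof (two_pi_sq_plus_ge t w k (Hlarge k Hk) Hw). pose proof (INR_S_ge_1 k). nra.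
  - set (eps := Rmin r 1). assert (Heps : 0 < eps) by (apply Rmin_pos; lra).
    pose proof (Rmin_l r 1). pose proof (Rmin_r r 1).
    apply (locally_dominated_Cnpow_mult G_expo _ t eps (2 * Q) (INR (2 * K + 2)) N
      (Cmod_G_expo_minus t) Heps).
    + rewrite Re_G_expo, plus_INR, mult_INR. simpl INR. lra.
    + intros k Hk. pose proof (INR_S_ge_1 k).
      rewrite <- pow_inv_Rpower, pow_add, (pow_inv _ 2) by lra.
      apply lip_bounded_mult; [exact Heps | now apply lip_bounded_le with r Q; try lra|].
      assert (Hinv : 0 <= (/ INR (S k)) ^ (2 * K))
        by (apply pow_le; left; apply Rinv_0_lt_compat; lra).
      apply lip_bounded_le with eps (Cmod ((/ INR (S k)) ^ (2 * K))%R * / INR (S k) ^ 2);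
        [apply Rle_refl | rewrite Cmod_R, Rabs_pos_eq by exact Hinv; apply Rle_refl|].
      apply lip_bounded_scal, lip_bounded_Cinv_shift; [nra | exact Heps|]. intros w Hw.
      apply (two_pi_sq_plus_ge t); [now apply Hlarge|]. unfold eps in Hw. lra.
Qed.

Lemma ex_series_G_rem_term (K : nat) (t : C) :
  Im t < 3 / 2 + 2 * INR K -> ex_series_C (fun k => G_rem_term K k t).
Proof. intros Ht. now apply locally_dominated_ex_series, locally_dominated_G_rem_term. Qed.

Lemma C_holo_at_zeta_coef (J : nat) (t : C) : C_holo_at (zeta_coef J) t.
Proof. pose proof two_pi_neq_0. unfold zeta_coef. now holo. Qed.

Lemma C_holo_at_zeta_arg (J : nat) (t : C) : C_holo_at (zeta_arg J) t.
Proof. unfold zeta_arg, G_expo. holo. Qed.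

Lemma C_holo_at_Cnpow_G_expo (n : nat) (t : C) : C_holo_at (fun w => Cnpow n (G_expo w)) t.
Proof.
  apply (C_holo_at_comp (Cnpow n) G_expo); [apply C_holo_at_Rcpow | unfold G_expo; holo].
Qed.

Lemma C_holo_at_G_rem_term (K k : nat) (t : C) :
  (two_pi_sq k + t)%C <> 0 -> C_holo_at (G_rem_term K k) t.
Proof.
  intros Ht. induction K as [|K IH].
  - apply (C_holo_at_mult (fun w => Cnpow (S k) (G_expo w)) (fun w => w / (two_pi_sq k + w))%C);
      [apply C_holo_at_Cnpow_G_expo | now holo].
  - apply (C_holo_at_minus (G_rem_term K k)); [exact IH|].
    apply C_holo_at_mult; [apply C_holo_at_zeta_coef|].
    apply (C_holo_at_comp (Cnpow (S k)) (fun w => - zeta_arg K w)%C); [apply C_holo_at_Rcpow|].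
    apply C_holo_at_opp, C_holo_at_zeta_arg.
Qed.

(** * The continuation of G *)

Definition G_rem (K : nat) (t : C) : C := CSeries (fun k => G_rem_term K k t).

Lemma C_holo_at_G_rem (K : nat) (t : C) : Im t < 3 / 2 + 2 * INR K ->
  (forall k, (two_pi_sq k + t)%C <> 0) -> C_holo_at (G_rem K) t.
Proof.
  intros Ht Hpole. apply C_holo_at_CSeries; [now apply locally_dominated_G_rem_term|].
  intros k. now apply C_holo_at_G_rem_term.
Qed.

Lemma C_holo_at_G_rem_omit (K m : nat) (t : C) : Im t < 3 / 2 + 2 * INR K ->
  (forall k, k <> m -> (two_pi_sq k + t)%C <> 0) ->
  C_holo_at (fun w => CSeries (omit m (fun k => G_rem_term K k w))) t.
Proof.
  intros Ht Hpole. apply (C_holo_at_CSeries (fun k w => omit m (fun i => G_rem_term K i w) k)).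
  - now apply locally_dominated_omit, locally_dominated_G_rem_term.
  - intros k. destruct (Nat.eq_dec k m) as [-> | Hk].
    + apply C_holo_at_ext with (fun _ => RtoC 0); [intros w; now rewrite omit_eq|].
      apply C_holo_at_const.
    + apply C_holo_at_ext with (G_rem_term K k); [intros w; now rewrite omit_neq|].
      now apply C_holo_at_G_rem_term, Hpole.
Qed.

Lemma G_rem_S (K : nat) (t : C) : Im t < 3 / 2 + 2 * INR K ->
  G_rem (S K) t = (G_rem K t - zeta_coef K t * zeta (zeta_arg K t))%C.
Proof.
  intros Ht. pose proof (ex_series_G_rem_term K t Ht).
  assert (Hz : ex_series_C (fun k => Cnpow (S k) (- zeta_arg K t)))
    by (apply ex_series_zeta; rewrite Re_zeta_arg; lra).
  unfold G_rem, zeta.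
  rewrite <- CSeries_scal, <- CSeries_minus by auto using ex_series_C_scal. reflexivity.
Qed.

Fixpoint G_zeta_part (K : nat) (t : C) : C :=
  match K with
  | O => 0
  | S J => (G_zeta_part J t
            + zeta_coef J t * (/ (zeta_arg J t - 1) + zeta_reg (zeta_arg J t)))%C
  end.

Lemma G_zeta_part_S (K : nat) (t : C) : G_zeta_part (S K) t
  = (G_zeta_part K t + zeta_coef K t * (/ (zeta_arg K t - 1) + zeta_reg (zeta_arg K t)))%C.
Proof. reflexivity. Qed.

Definition G_ext_upto (K : nat) (t : C) : C := (G_zeta_part K t + G_rem K t)%C.

Lemma G_ext_upto_S (K : nat) (t : C) : Im t < 3 / 2 + 2 * INR K ->
  G_ext_upto (S K) t = G_ext_upto K t.
Proof.
  intros Ht. unfold G_ext_upto.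
  rewrite G_rem_S, zeta_reg_regular, G_zeta_part_S; [ring | rewrite Re_zeta_arg; lra | exact Ht].
Qed.

Definition G_height (t : C) : R := (Im t - 3 / 2) / 2.

Definition G_ext : C -> C := glue G_height G_ext_upto.

Lemma G_ext_upto_height_S (K : nat) (t : C) :
  G_height t < INR K -> G_ext_upto (S K) t = G_ext_upto K t.
Proof. unfold G_height. intros Ht. apply G_ext_upto_S. lra. Qed.

Lemma G_ext_eq_upto (K : nat) (t : C) : Im t < 3 / 2 + 2 * INR K -> G_ext t = G_ext_upto K t.
Proof.
  intros Ht. apply glue_eq; [|unfold G_height; lra].
  intros q. apply G_ext_upto_height_S.
Qed.

Lemma is_series_G_ext (t : C) : Im t < 3 / 2 -> is_series_C (fun k => G_term t (S k)) (G_ext t).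
Proof.
  intros Ht. assert (Ht0 : Im t < 3 / 2 + 2 * INR 0) by (simpl; lra).
  rewrite (G_ext_eq_upto 0) by exact Ht0.
  replace (G_ext_upto 0 t) with (G_rem 0 t) by (unfold G_ext_upto; simpl; ring).
  now apply CSeries_correct, (ex_series_G_rem_term 0).
Qed.

Definition imag_pole (J : nat) : C := (0, 2 * INR (S J) - 1 / 2).

Lemma Im_imag_pole (J : nat) : Im (imag_pole J) = 2 * INR (S J) - 1 / 2.
Proof. reflexivity. Qed.

Lemma zeta_arg_imag_pole (J : nat) (t : C) : (zeta_arg J t - 1 = Ci * (t - imag_pole J))%C.
Proof.
  destruct t as [x y]. unfold zeta_arg, G_expo, imag_pole. rewrite mult_INR.
  change (INR 2) with 2. unfold Cminus, Cplus, Copp, Cmult, Ci, RtoC; simpl fst; simpl snd.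
  f_equal; field.
Qed.

Lemma Ci_neq_0 : Ci <> 0.
Proof. apply Im_neq_0. simpl. lra. Qed.

Lemma C_holo_at_zeta_reg_arg (J : nat) (t : C) : C_holo_at (fun w => zeta_reg (zeta_arg J w)) t.
Proof.
  apply (C_holo_at_comp zeta_reg (zeta_arg J));
    [apply C_holo_at_zeta_reg | apply C_holo_at_zeta_arg].
Qed.

Lemma C_holo_at_G_zeta_part (K : nat) (t : C) :
  (forall J, (J < K)%nat -> t <> imag_pole J) -> C_holo_at (G_zeta_part K) t.
Proof.
  induction K as [|K IH]; intros Ht; [apply C_holo_at_const|].
  apply (C_holo_at_plus (G_zeta_part K)); [apply IH; intros; apply Ht; lia|].
  apply C_holo_at_mult; [apply C_holo_at_zeta_coef|].
  apply C_holo_at_plus; [|apply C_holo_at_zeta_reg_arg].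
  apply C_holo_at_inv; [apply C_holo_at_minus; [apply C_holo_at_zeta_arg | apply C_holo_at_const]|].
  rewrite zeta_arg_imag_pole. apply Cmult_neq_0; [exact Ci_neq_0|]. apply Cminus_neq_0, Ht. lia.
Qed.

Lemma G_pole_iff (p : C) :
  G_pole p <-> (exists J, p = imag_pole J) \/ (exists k, p = (- two_pi_sq k)%C).
Proof.
  assert (Hreal : forall k, (- two_pi_sq k)%C = (- (2 * PI * INR (S k) ^ 2), 0))
    by (intros k; unfold two_pi_sq, Copp, RtoC; simpl; f_equal; ring).
  split.
  - intros [[[|J] [Hn ->]] | [[|k] [Hn ->]]]; [lia | left; now exists J | lia | right].
    exists k. now rewrite Hreal.
  - intros [[J ->] | [k ->]]; [left | right].
    + exists (S J). split; [lia | reflexivity].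
    + exists (S k). split; [lia | apply Hreal].
Qed.

Lemma C_holo_at_G_ext (t : C) : ~ G_pole t -> C_holo_at G_ext t.
Proof.
  rewrite G_pole_iff. intros Ht. apply C_holo_at_glue.
  - intros w. pose proof (im_le_Cmod (w - t)) as Him. pose proof (Rle_abs (Im (w - t)%C)).
    pose proof (Cmod_ge_0 (w - t)). change (Im (w - t)%C) with (Im w - Im t) in *.
    unfold G_height. lra.
  - intros w q. apply G_ext_upto_height_S.
  - unfold G_height. intros K HK. apply C_holo_at_plus.
    + apply C_holo_at_G_zeta_part. intros J _ E. apply Ht. left. now exists J.
    + apply C_holo_at_G_rem; [lra|]. intros k E. apply Ht. right. exists k.
      replace t with (two_pi_sq k + t - two_pi_sq k)%C by ring. rewrite E. ring.
Qed.

(** * Simple poles *)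

(* An explicit quotient takes the place of the removable singularity theorem. *)
Definition has_entire_slope (g : C -> C) (p : C) : Prop :=
  exists Q : C -> C, (forall z, C_holo_at Q z) /\ forall z, g z = (g p + (z - p) * Q z)%C.

Lemma has_entire_slope_const (c p : C) : has_entire_slope (fun _ => c) p.
Proof. exists (fun _ => RtoC 0). split; [intros; apply C_holo_at_const | intros; ring]. Qed.

Lemma has_entire_slope_id (p : C) : has_entire_slope (fun z => z) p.
Proof. exists (fun _ => RtoC 1). split; [intros; apply C_holo_at_const | intros; ring]. Qed.

Lemma has_entire_slope_opp (f : C -> C) (p : C) :
  has_entire_slope f p -> has_entire_slope (fun z => - f z)%C p.
Proof.
  intros [Q [HQ Ef]]. exists (fun z => - Q z)%C. split.
  - intros z. now apply C_holo_at_opp.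
  - intros z. rewrite (Ef z). ring.
Qed.

Lemma has_entire_slope_minus (f g : C -> C) (p : C) :
  has_entire_slope f p -> has_entire_slope g p -> has_entire_slope (fun z => f z - g z)%C p.
Proof.
  intros [P [HP Ef]] [Q [HQ Eg]]. exists (fun z => P z - Q z)%C. split.
  - intros z. now apply C_holo_at_minus.
  - intros z. rewrite (Ef z), (Eg z). ring.
Qed.

Lemma has_entire_slope_mult (f g : C -> C) (p : C) :
  has_entire_slope f p -> has_entire_slope g p -> has_entire_slope (fun z => f z * g z)%C p.
Proof.
  intros [P [HP Ef]] [Q [HQ Eg]].
  exists (fun z => P z * g p + (f p + (z - p) * P z) * Q z)%C. split.
  - intros z. specialize (HP z). specialize (HQ z). holo.
  - intros z. rewrite (Ef z), (Eg z). ring.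
Qed.

Lemma has_entire_slope_pow (f : C -> C) (n : nat) (p : C) :
  has_entire_slope f p -> has_entire_slope (fun z => f z ^ n)%C p.
Proof.
  intros Hf. induction n as [|n IH]; [exact (has_entire_slope_const 1 p)|].
  exact (has_entire_slope_mult f (fun z => f z ^ n)%C p Hf IH).
Qed.

Lemma has_entire_slope_Cexp (f : C -> C) (p : C) :
  has_entire_slope f p -> has_entire_slope (fun z => Cexp (f z)) p.
Proof.
  intros [Q [HQ Ef]]. exists (fun z => Cexp (f p) * (Q z * expq ((z - p) * Q z)))%C. split.
  - intros z. specialize (HQ z).
    apply C_holo_at_mult; [apply C_holo_at_const|]. apply C_holo_at_mult; [exact HQ|].
    apply (C_holo_at_comp expq (fun w => (w - p) * Q w)%C); [apply C_holo_at_expq | holo].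
  - intros z. rewrite (Ef z), Cexp_plus, (Cexp_expq ((z - p) * Q z)). ring.
Qed.

Lemma simple_pole_of_quotient (F g h : C -> C) (p : C) (r : R) :
  has_entire_slope g p -> g p <> 0 -> 0 < r ->
  (forall z, Cmod (z - p) < r -> C_holo_at h z) ->
  (forall z, Cmod (z - p) < r -> z <> p -> F z = (g z / (z - p) + h z)%C) ->
  simple_pole F p.
Proof.
  intros [Q [HQ Eg]] Hgp Hr Hh EF. exists (g p). split; [exact Hgp|].
  exists r. split; [exact Hr|]. exists (fun z => Q z + h z)%C. split.
  - intros z Hz. apply C_holo_at_plus; auto.
  - intros z Hz Hzp. rewrite EF, (Eg z) by assumption.
    pose proof (Cminus_neq_0 z p Hzp). field. assumption.
Qed.

Lemma has_entire_slope_zeta_coef (J : nat) (p : C) : has_entire_slope (zeta_coef J) p.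
Proof.
  apply (has_entire_slope_mult (fun t => t / (2 * PI)%R)%C (fun t => (- t / (2 * PI)%R) ^ J)%C).
  - apply (has_entire_slope_mult (fun t => t) (fun _ => / (2 * PI)%R)%C);
      [apply has_entire_slope_id | apply has_entire_slope_const].
  - apply (has_entire_slope_pow (fun t => - t / (2 * PI)%R)%C).
    apply (has_entire_slope_mult (fun t => - t)%C (fun _ => / (2 * PI)%R)%C);
      [apply has_entire_slope_opp, has_entire_slope_id | apply has_entire_slope_const].
Qed.

Lemma zeta_coef_neq_0 (J : nat) (t : C) : t <> 0 -> zeta_coef J t <> 0.
Proof.
  intros Ht. pose proof two_pi_neq_0. unfold zeta_coef.
  apply Cmult_neq_0; [now apply Cdiv_neq_0|]. apply Cpow_nz, Cdiv_neq_0; [|assumption].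
  intros E. apply Ht. replace t with (- - t)%C by ring. rewrite E. ring.
Qed.

Lemma simple_pole_G_ext_imag (K : nat) : simple_pole G_ext (imag_pole K).
Proof.
  pose proof (INR_S_ge_1 K). pose proof Ci_neq_0 as Hi.
  apply simple_pole_of_quotient with (r := 1 / 2) (g := fun z => (zeta_coef K z * / Ci)%C)
    (h := fun z => (G_zeta_part K z + zeta_coef K z * zeta_reg (zeta_arg K z) + G_rem (S K) z)%C).
  - apply has_entire_slope_mult; [apply has_entire_slope_zeta_coef | apply has_entire_slope_const].
  - apply Cdiv_neq_0; [|exact Hi]. apply zeta_coef_neq_0, Im_neq_0. rewrite Im_imag_pole. lra.
  - lra.
  - intros z Hz%Im_close. rewrite Im_imag_pole in Hz.
    apply C_holo_at_plus; [apply C_holo_at_plus|].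
    + apply C_holo_at_G_zeta_part. intros J HJ ->. rewrite Im_imag_pole in Hz.
      apply le_INR in HJ. rewrite S_INR in Hz. lra.
    + apply C_holo_at_mult; [apply C_holo_at_zeta_coef | apply C_holo_at_zeta_reg_arg].
    + apply C_holo_at_G_rem; [lra|]. intros k. apply Im_neq_0.
      change (0 + Im z <> 0). lra.
  - intros z Hz%Im_close Hzp. rewrite Im_imag_pole in Hz.
    rewrite (G_ext_eq_upto (S K)) by lra. unfold G_ext_upto.
    rewrite G_zeta_part_S, zeta_arg_imag_pole.
    pose proof (Cminus_neq_0 z _ Hzp). field. now split.
Qed.

Lemma two_pi_sq_isolated (k m : nat) (z : C) :
  k <> m -> Cmod (z - - two_pi_sq m) < 1 -> (two_pi_sq k + z)%C <> 0.
Proof.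
  intros Hkm Hz%Re_close E. apply (f_equal Re) in E.
  pose proof (INR_S_ge_1 k). pose proof (INR_S_ge_1 m). pose proof PI2_1.
  assert (Hk : 2 * PI * INR (S k) ^ 2 + Re z = 0) by exact E.
  assert (Hm : - (2 * PI * INR (S m) ^ 2) - 1 < Re z < - (2 * PI * INR (S m) ^ 2) + 1) by exact Hz.
  assert (Hgap : forall i j, (i < j)%nat -> 1 <= INR (S j) ^ 2 - INR (S i) ^ 2).
  { intros i j Hij. pose proof (INR_S_ge_1 i).
    assert (INR (S i) + 1 <= INR (S j)) by (rewrite <- S_INR; apply le_INR; lia). nra. }
  destruct (Nat.lt_gt_cases k m) as [[Hlt | Hgt] _]; [exact Hkm | |];
    [pose proof (Hgap k m Hlt) | pose proof (Hgap m k Hgt)]; nra.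
Qed.

Lemma has_entire_slope_Cnpow_G_expo (n : nat) (p : C) :
  has_entire_slope (fun z => Cnpow n (G_expo z)) p.
Proof.
  apply (has_entire_slope_Cexp (fun z => G_expo z * ln (INR n))%C).
  apply has_entire_slope_mult; [|apply has_entire_slope_const].
  apply (has_entire_slope_minus (fun _ => RtoC (- (1 / 2))) (fun z => Ci * z)%C);
    [apply has_entire_slope_const|].
  apply (has_entire_slope_mult (fun _ => Ci) (fun z => z));
    [apply has_entire_slope_const | apply has_entire_slope_id].
Qed.

Lemma simple_pole_G_ext_real (m : nat) : simple_pole G_ext (- two_pi_sq m)%C.
Proof.
  set (p := (- two_pi_sq m)%C).
  assert (Hstrip : forall z, Cmod (z - p) < 1 -> Im z < 3 / 2 + 2 * INR 0).
  { intros z Hz%Im_close. change (Im p) with (- 0) in Hz. simpl. lra. }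
  apply simple_pole_of_quotient with (r := 1) (g := fun z => (Cnpow (S m) (G_expo z) * z)%C)
    (h := fun z => CSeries (omit m (fun k => G_rem_term 0 k z))).
  - apply has_entire_slope_mult; [apply has_entire_slope_Cnpow_G_expo | apply has_entire_slope_id].
  - apply Cmult_neq_0; [apply Cexp_neq_0|]. apply Re_neq_0.
    change (- (2 * PI * INR (S m) ^ 2) <> 0). pose proof (INR_S_ge_1 m). pose proof PI2_1. nra.
  - lra.
  - intros z Hz. apply C_holo_at_G_rem_omit; [now apply Hstrip|].
    intros k Hk. now apply two_pi_sq_isolated with m.
  - intros z Hz%Hstrip Hzp. rewrite (G_ext_eq_upto 0) by exact Hz. unfold G_ext_upto, G_rem.
    rewrite (CSeries_omit _ m) by now apply ex_series_G_rem_term.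
    change (G_rem_term 0 m z) with (Cnpow (S m) (G_expo z) * (z / (two_pi_sq m + z)))%C.
    replace (two_pi_sq m + z)%C with (z - p)%C by (unfold p; ring).
    pose proof (Cminus_neq_0 z p Hzp). simpl G_zeta_part. field. assumption.
Qed.

Theorem mainTheorem10 :
  exists F : C -> C,
    (forall t : C, Im t < 3/2 -> ~ G_pole t ->
       @is_series C_AbsRing C_NormedModule (fun k => G_term t (S k)) (F t)) /\
    (forall z : C, ~ G_pole z -> C_holo_at F z) /\
    (forall p : C, G_pole p -> simple_pole F p).
Proof.
  exists G_ext. split; [|split].
  - intros t Ht _. now apply is_series_G_ext.
  - exact C_holo_at_G_ext.
  - intros p [[J ->] | [k ->]]%G_pole_iff;
      [apply simple_pole_G_ext_imag | apply simple_pole_G_ext_real].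
Qed.
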